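(* (a) Let $E\in\mathbb Z$ and let $$\tau^{(E,F)}(N,n,\mathbf p^{(1)},\dots,\mathbf p^{(F)})=\sum_{\lambda,\ \ell(\lambda)\le N}r_\lambda(n)\,(\chi_\lambda(1))^{E-F}\prod_{j=1}^{F}s_\lambda(\mathbf p^{(j)}),\qquad r_\lambda(n)=e^{\beta f(\lambda,n)}\prod_{i=1}^k\Big(\frac{s_\lambda(\mathbf p(q_it_i^n,t_i))}{s_\lambda(\mathbf p(0,t_i))}\Big)^{n_i},$$ with complex parameters $q_i,t_i,n_i$. Then the series labelled by $E-1,F-1$ is obtained from the series labelled by $E,F$ by $$\tau^{(E-1,F-1)}(N,n,\mathbf p^{(1)},\dots,\mathbf p^{(F-1)})=\Big[e^{L^{(F)}}\cdot\tau^{(E,F)}(N,n,\mathbf p^{(1)},\dots,\mathbf p^{(F)})\Big]_{\mathbf p^{(F)}=0},$$ where $$L^{(F)}=\sum_{m>0}\left(\frac m2\frac{\partial^2}{\partial p_m^2}+\frac{\partial}{\partial p_{2m-1}}\right),\qquad p_m=p_m^{(F)}.$$ (b) Let $r$ be a function on $\mathbb Z$, fix $n$, let $N=n-M$, and let $r'(x)=r(x)\delta(x)$, where $\delta(M)=0$ and $\delta(x)=1$ otherwise. Then the BKP hypergeometric tau function $\tau^{\rm BKP}_r$ is obtained from the hypergeometric tau function $\tau^{\rm TL}_{r'}$ of the semi-infinite Toda lattice with origin $M=n-N$ by $$\tau_r^{\rm BKP}(N,n,\mathbf p)=\Big[e^{\frac12L_\infty}\cdot\tau^{\rm TL}_{r'}(n-N;n,\mathbf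 p,\bar{\mathbf p})\Big]_{\bar{\mathbf p}=0},\qquad L_\infty=\sum_{m\ge1}m\frac{\partial^2}{\partial\bar p_m^2}+2\sum_{m\ge1,\ m\ \mathrm{odd}}m\frac{\partial}{\partial\bar p_m}.$$
   Context: $\lambda$ runs over partitions, $\ell(\lambda)$ is the number of nonzero parts and $d=|\lambda|$ the weight. $\chi_\lambda$ is the irreducible character of $S_d$ labelled by $\lambda$, $\chi_\lambda(\Delta)$ its value on the class $C_\Delta$ of cycle type $\Delta$, $\chi_\lambda(1)=\dim\lambda$. For $\mathbf p=(p_1,p_2,\dots)$ and $\Delta=(d_1,d_2,\dots)$, $\mathbf p_\Delta=p_{d_1}p_{d_2}\cdots$, and the Schur functions in power-sum variables are $s_\lambda(\mathbf p)=\frac1{d!}\sum_{|\Delta|=d}|C_\Delta|\chi_\lambda(\Delta)\mathbf p_\Delta$. In (a): $\mathbf p(Q,t)$ has components $p_m(Q,t)=\frac{1-Q^m}{1-t^m}$, and $f(\lambda,n)=n|\lambda|+|C_\Gamma|\frac{\chi_\lambda(\Gamma)}{\chi_\lambda(1)}$ with $\Gamma=(1^{d-2}2)$. In (b): $r_\lambda(n)=\prod_{(a,b)\in\lambda}r(n+b-a)$ (product over the boxes of the Young diagram, row $a$, column $b$), $$\tau_r^{\rm BKP}(N,n,\mathbf p)=g(n)\sum_{\ell(\lambda)\le N}r_\lambda(n)s_\lambda(\mathbf p),\qquad \tau^{\rm TL}_{r'}(M;n,\mathbf p,\bar{\mathbf p})=g(n)\sum_{\ell(\lambda)\le n-M}r_\lambda(n)s_\lambda(\mathbf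 p)s_\lambda(\bar{\mathbf p}),$$ where $g(n)$ is a constant independent of $\mathbf p,\bar{\mathbf p}$; the restriction $\ell(\lambda)\le n-M$ is the effect of replacing $r$ by $r'$, since $r'(M)=0$.
   Formalization: In (b) the factor m in the first-order term of L_∞ is dropped: L_∞ = Σ m ∂²/∂p̄_m² + 2 Σ_{m odd} ∂/∂p̄_m, matching (a). As printed, (b) fails for r = 1, N ≥ 1 in weight 3: [e^{L_∞/2} s_(3)] at p̄ = 0 is 5/3, not 1. *)

(* Defs.v *)
From HB Require Import structures.
From mathcomp Require Import all_boot all_order all_algebra all_fingroup.
From mathcomp Require Import archimedean algC classfun character.
From mathcomp Require Import finmap monalg complex.
From mathcomp Require Import boolp classical_sets fsbigop reals.
From mathcomp Require Import sequences exp trigo.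
From mathcomp Require Import zify.

Set Implicit Arguments.
Unset Strict Implicit.
Unset Printing Implicit Defensive.

Import Order.TTheory GRing.Theory Num.Theory.

Local Open Scope ring_scope.

(* A partition is the weakly decreasing list of its nonzero parts, so that    *)
(* l(la) is size la and |la| is sumn la.                                      *)
Definition is_part (la : seq nat) : bool := sorted geq la && (0%N \notin la).

Definition conj_part (la : seq nat) : seq nat :=
  mkseq (fun j => count (ltn j) la) (head 0%N la).

Definition partitions (d : nat) : set (seq nat) :=
  [set la | is_part la /\ sumn la = d]%classic.

(* N is an integer: for N < 0 there is no such partition.                     *)
Definition partitions_le (N : int) (d : nat) : set (seq nat) :=
  [set la | partitions d la /\ (size la)%:Z <= N]%classic.

Section SymmetricGroup.

Variable d : nat.

Definition cycle_type (s : 'S_d) : seq nat :=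
  sort geq (map (fun c : {set 'I_d} => #|c|) (enum (porbits s))).

Definition cclass (De : seq nat) : {set 'S_d} :=
  [set s : 'S_d | cycle_type s == De].

(* The Young subgroup S_(la_1) x S_(la_2) x ... acting on consecutive blocks  *)
(* of lengths la_1, la_2, ... ; reshape_index la i is the block of i.         *)
Definition young_set (la : seq nat) : {set 'S_d} :=
  [set s : 'S_d | [forall i : 'I_d,
     reshape_index la (s i) == reshape_index la i]].

Lemma young_group_set la : group_set (young_set la).
Proof.
apply/group_setP; split=> [|s t].
  by rewrite inE; apply/forallP => i; rewrite perm1.
rewrite !inE => /forallP hs /forallP ht; apply/forallP => i.
by rewrite permM (eqP (ht _)) (eqP (hs _)).
Qed.

Canonical young (la : seq nat) : {group 'S_d} := Group (young_group_set la).

Fact sgn_is_class_fun :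
  is_class_fun <<[set: 'S_d]>>%g [ffun s : 'S_d => (-1) ^+ (odd_perm s) : algC].
Proof.
apply: intro_class_fun => [s t _ _|s]; first by rewrite odd_permJ.
by rewrite /= mem_gen ?inE.
Qed.

Definition sgn_cf : 'CF([set: 'S_d]) := Cfun 0 sgn_is_class_fun.

(* The irreducible character labelled by la is the only common constituent of *)
(* the characters induced from 1 on S_la and from the sign on S_la', where    *)
(* la' is the conjugate partition; (d) labels the trivial character.          *)
Definition irr_part (la : seq nat) : Iirr [set: 'S_d] :=
  odflt 0 [pick i |
    (i \in irr_constt ('Ind[[set: 'S_d], young la] 1)) &&
    (i \in irr_constt ('Ind[[set: 'S_d], young (conj_part la)]
                         ('Res[young (conj_part la)] sgn_cf)))].

(* Characters of symmetric groups take rational integer values: floor only    *)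
(* moves these values from algC to int.                                       *)
Definition irr_val (la : seq nat) (s : 'S_d) : int :=
  Num.floor ('chi_(irr_part la) s).

End SymmetricGroup.

Arguments cclass : clear implicits.

Definition chi (la De : seq nat) : int :=
  irr_val la (repr (cclass (sumn la) De)).

Definition chi1 (la : seq nat) : int := irr_val la (1%g : 'S_(sumn la)).

Section Series.

Variable R : realType.
Local Notation C := R[i].

Definition cexp (z : C) : C :=
  ((expR (complex.Re z) * cos (complex.Im z)) +i*
   (expR (complex.Re z) * sin (complex.Im z)))%C.

(* z ^ w for the determination Log of the logarithm.                          *)
Definition cpow (Log : C -> C) (z w : C) : C :=
  if z == 0 then (w == 0)%:R else cexp (w * Log z).

Definition psum_part (A : comAlgType C) (p : nat -> A) (De : seq nat) : A :=
  \prod_(m <- De) p m.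

Definition schur (A : comAlgType C) (la : seq nat) (p : nat -> A) : A :=
  ((sumn la)`!%:R^-1 : C) *:
    \sum_(De \in partitions (sumn la))
      ((#|cclass (sumn la) De|%:R * (chi la De)%:~R : C) *: psum_part p De).

(* Polynomials over C in the variables p^(j)_m, j and m natural numbers.      *)
Local Notation ppoly := {malg C[{cmonom (nat * nat)%type}]}.

Definition pvar (j m : nat) : ppoly := << ucm (j, m) >>.

Definition pderiv (j m : nat) (f : ppoly) : ppoly :=
  \sum_(k <- msupp f) << (f@_k *+ k (j, m)) *g divcm k (ucm (j, m)) >>.

Definition psubst (phi : nat -> nat -> ppoly) (f : ppoly) : ppoly :=
  mmap malgC
    (fun k : {cmonom (nat * nat)%type} =>
       \prod_(v <- finsupp k) phi v.1 v.2 ^+ k v) f.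

Definition at_p0 (j : nat) (f : ppoly) : ppoly :=
  psubst (fun i m => if i == j then 0 else pvar i m) f.

(* The sums over m below and over k here are finite for a given polynomial:   *)
(* L involves only finitely many of its variables, and lowers its degree.     *)
Definition exp_op (L : ppoly -> ppoly) (f : ppoly) : ppoly :=
  \sum_(k \in [set: nat]%classic) ((k`!%:R^-1 : C) *: iter k L f).

Definition L_op (j : nat) (f : ppoly) : ppoly :=
  \sum_(m \in [set m : nat | (0 < m)%N]%classic)
    (((m%:R / 2) : C) *: pderiv j m (pderiv j m f) + pderiv j (2 * m).-1 f).

(* A series over partitions is given by its components of weight |la| = d,    *)
(* each of which is a finite sum, hence a polynomial when p consists of       *)
(* variables; operators and substitutions act on each component.              *)
Definition tau (A : comAlgType C) (r : seq nat -> int -> C) (E : int) (F : nat)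
    (N n : int) (p : nat -> nat -> A) (d : nat) : A :=
  \sum_(la \in partitions_le N d)
    ((r la n * (chi1 la)%:~R ^ (E - F%:Z)) *:
       \prod_(1 <= j < F.+1) schur la (p j)).

(* For |la| < 2 the class of (1^(d-2) 2) is empty and f(la, n) = n |la|.      *)
Definition f_part (la : seq nat) (n : int) : C :=
  let Ga := 2%N :: nseq (sumn la - 2) 1%N in
  n%:~R * (sumn la)%:R +
  #|cclass (sumn la) Ga|%:R * ((chi la Ga)%:~R / (chi1 la)%:~R).

Definition pQt (Q t : C) (m : nat) : C^o := (1 - Q ^+ m) / (1 - t ^+ m).

(* The determination of the i-th logarithm may depend on la.                  *)
Definition r_exp (beta : C) (k : nat) (q t nu : 'I_k -> C)
    (Log : 'I_k -> seq nat -> C -> C) (la : seq nat) (n : int) : C :=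
  cexp (beta * f_part la n) *
  \prod_(i < k)
    cpow (Log i la) (schur la (pQt (q i * t i ^ n) (t i)) /
                     schur la (pQt 0 (t i))) (nu i).

(* Rows and columns are numbered from 0 here, which does not change b - a.    *)
Definition r_content (r : int -> C) (la : seq nat) (n : int) : C :=
  \prod_(0 <= a < size la) \prod_(0 <= b < nth 0%N la a)
    r (n + b%:Z - a%:Z).

Definition cut (r : int -> C) (M : int) (x : int) : C :=
  r x * (if x == M then 0 else 1).

(* Cutting r at M restricts a sum over partitions to l(la) <= n - M: the box  *)
(* of content M - n lies in the first column, in the row n - M (from 0).      *)
Lemma r_content_cut (r : int -> C) (M n : int) (la : seq nat) :
  is_part la -> M <= n ->
  r_content (cut r M) la n =
    if (size la)%:Z <= n - M then r_content r la n else 0.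
Proof.
move=> /andP[_ la0] leMn.
have [ltn_la|len_la] := ltP (n - M) (size la)%:Z; last first.
  apply: eq_big_nat => a /andP[_ ltas]; apply: eq_bigr => b _.
  rewrite /cut; case: eqP => [eqM|_]; last by rewrite mulr1.
  by exfalso; lia.
pose a := absz (n - M).
have ltas : (a < size la)%N by rewrite /a; lia.
have aE : a%:Z = n - M by rewrite /a; lia.
rewrite /r_content big_mkord (bigD1 (Ordinal ltas)) //=.
have la_gt0 : (0 < nth 0 la a)%N.
  by rewrite lt0n; apply: contraNneq la0 => <-; rewrite mem_nth.
rewrite [X in X * _]big_mkord (bigD1 (Ordinal la_gt0)) //= /cut aE.
by rewrite addr0 opprB addrC subrK eqxx mulr0 !mul0r.
Qed.

Definition tauBKP (A : comAlgType C) (g r : int -> C) (N n : int)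
    (p : nat -> A) (d : nat) : A :=
  g n *: \sum_(la \in partitions_le N d) (r_content r la n *: schur la p).

Definition tauTL (A : comAlgType C) (g r : int -> C) (M n : int)
    (p pbar : nat -> A) (d : nat) : A :=
  g n *: \sum_(la \in partitions_le (n - M) d)
    (r_content r la n *: (schur la p * schur la pbar)).

(* The first order terms have coefficient 2, with no factor m, so that half   *)
(* of Linf is L_op: p_m and m d/dp_m are adjoint, and the sum of all Schur    *)
(* functions is exp (sum_m p_m^2 / 2m + sum_(m odd) p_m / m). With 2m in      *)
(* place of 2, exp (Linf / 2) sends s_(3) to 5/3 instead of 1 at p = 0.       *)
Definition Linf (j : nat) (f : ppoly) : ppoly :=
  \sum_(m \in [set m : nat | (1 <= m)%N]%classic)
    ((m%:R : C) *: pderiv j m (pderiv j m f)) +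
  (2 : C) *: \sum_(m \in [set m : nat | (1 <= m)%N && odd m]%classic)
    pderiv j m f.

End Series.

(* Main.v *)
Require Import Defs.
From HB Require Import structures.
From mathcomp Require Import boolp classical_sets cardinality fsbigop.
From mathcomp Require Import all_boot all_order all_algebra all_fingroup.
From mathcomp Require Import cyclic falgebra fieldext galois algC algnum.
From mathcomp Require Import mxrepresentation classfun character integral_char.
From mathcomp Require Import finmap monalg complex reals.
From mathcomp Require Import zify ring.

Set Implicit Arguments.
Unset Strict Implicit.
Unset Printing Implicit Defensive.

Import Order.TTheory GRing.Theory Num.Theory.
Local Open Scope ring_scope.

(* Write [L] for [L_op j]. Since [m d/dp_m + [m odd]] commutes with [L] and   *)
(* is the commutator of [L] with [p_m], the functional [W f = (e^L f) at p=0] *)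
(* satisfies [W (p_m f) = W ((m d/dp_m + [m odd]) f)]. The number of square   *)
(* roots of a permutation obeys the same recursion on its cycles, so          *)
(* [W p_De = #{h | h^2 = g}] for [g] of cycle type [De], and [W s_la] is the  *)
(* Frobenius-Schur indicator of [chi_la]. All indicators of the symmetric     *)
(* group are 1: if every [g] in [G] is inverted by an element of [H], then    *)
(* [sum m^2 = sum eps(chi) eps(psi) m], where [m = <Res chi, psi>], as both   *)
(* sides count the [H]-classes of [G]; as [eps <= 1 <= m] when [m != 0], the  *)
(* indicators equal to 1 propagate from a point stabilizer [H] to [G].        *)

(** * Permutations with prescribed orbits *)

(** Both parts rest on one identity, [exp_L_eval_schur]: applying [e^L] to any Schur function [s_la]
    in the family [j] and setting that family to 0 gives 1. The operator differentiates in one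
    family only, so this evaluation is linear over the Schur functions of the other families
    ([exp_L_eval_prod_schur]), and in each summand of a tau function it erases exactly the factor
    [s_la(p^(j))]. In (a) the exponent [E - F] of the dimension is unchanged; in (b) half of [Linf]
    is [L_op] ([half_Linf]), and on the surviving partitions cutting [r] changes nothing
    ([r_content_cut]).

    The identity combines two computations. The evaluation of a product of power sums and the number
    of square roots of a permutation satisfy the same recursion in the cycle lengths
    ([heat_eval_power_cons], [card_sqrt_set]), so they agree ([exp_L_eval_cycle_type]). Averaging
    the number of roots against an irreducible character gives its Frobenius-Schur indicator, which
    is 1 for symmetric groups ([fs_indicator_Sym]). Integrality of the characters ([chi_Sn_int])
    ensures that the floor in [irr_val] loses nothing. *)

Section OrbitMaps.

Variable T : finType.
Implicit Types (s t z h : {perm T}) (x y : T) (A B : {set T}).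
Local Open Scope group_scope.

Lemma eq_permX_porbit s x i j :
  ((s ^+ i) x == (s ^+ j) x) = (i == j %[mod #|porbit s x|]).
Proof.
have m_gt0 : (0 < #|porbit s x|)%N by rewrite lt0n card_porbit_neq0.
have modE k : (s ^+ k) x = nth x (traject s x #|porbit s x|) (k %% #|porbit s x|).
  rewrite nth_traject ?ltn_mod// -permX.
  set m := #|porbit s x|; rewrite [in LHS](divn_eq k m) expgD permM mulnC expgM.
  congr ((s ^+ _) _); have smx : (s ^+ m) x = x by rewrite permX iter_porbit.
  by elim: (k %/ m)%N => [|n IH]; rewrite ?expg0 ?perm1 // expgS permM smx.
by rewrite !modE nth_uniq ?uniq_traject_porbit ?size_traject ?ltn_mod.
Qed.

Lemma porbit_permS s x : porbit s (s x) = porbit s x.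
Proof. by rewrite -{2}[s]expg1 porbit_perm. Qed.

(** The set [D] prescribes some of the representatives: these are the points at which the value of
    an intertwiner must be controlled. *)
Lemma porbit_repr_exists s (D : {set T}) :
  {in D &, forall x y, porbit s x = porbit s y -> x = y} ->
  exists rho : T -> T,
    [/\ forall x, rho x \in porbit s x,
        forall x y, porbit s x = porbit s y -> rho x = rho y
      & {in D, forall x, rho x = x}].
Proof.
move=> Dinj; pose rho x := if [pick y in D | y \in porbit s x] is Some y then y
  else odflt x [pick y in porbit s x].
exists rho; split=> [x|x y eq_xy|x Dx]; rewrite /rho.
- case: pickP => [y /andP[]//|_]; case: pickP => [y //|/(_ x)].
  by rewrite porbit_id.
- rewrite eq_xy; case: pickP => // _; case: pickP => // /(_ y).
  by rewrite porbit_id.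
- case: pickP => [y /andP[Dy]|/(_ x)]; last by rewrite Dx porbit_id.
  by rewrite -eq_porbit_mem => /eqP; apply: Dinj.
Qed.

(* An intertwiner is prescribed freely on orbit representatives, provided the *)
(* induced map of orbits is injective and preserves cardinals.                *)
Lemma perm_intertwiner s t (rho phi : T -> T) :
    (forall x, rho x \in porbit s x) ->
    (forall x y, porbit s x = porbit s y -> rho x = rho y) ->
    (forall x, #|porbit t (phi (rho x))| = #|porbit s x|) ->
    (forall x y, porbit t (phi (rho x)) = porbit t (phi (rho y)) ->
       porbit s x = porbit s y) ->
  exists c : {perm T}, [/\ s * c = c * t, forall x, c (rho x) = phi (rho x)
    & forall x, c x \in porbit t (phi (rho x))].
Proof.
move=> rhoP rho_eq phi_card phi_inj.
have rho_orb x : porbit s (rho x) = porbit s x.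
  by apply/eqP; rewrite eq_porbit_mem.
have /fin_all_exists[k kP] x : exists k, x = (s ^+ k) (rho x).
  by apply/porbitP; rewrite porbit_sym.
pose f x := (t ^+ k x) (phi (rho x)).
have f_orb x : porbit t (f x) = porbit t (phi (rho x)) by rewrite porbit_perm.
have fE x i : x = (s ^+ i) (rho x) -> f x = (t ^+ i) (phi (rho x)).
  move=> xE; apply/eqP; rewrite eq_permX_porbit phi_card -rho_orb.
  by rewrite -eq_permX_porbit -kP -xE.
have f_inj : injective f.
  move=> x y fxy; have xy : porbit s x = porbit s y.
    by apply: phi_inj; rewrite -!f_orb fxy.
  have rxy := rho_eq _ _ xy; move: fxy; rewrite /f rxy => /eqP.
  rewrite eq_permX_porbit phi_card -rho_orb -eq_permX_porbit.
  by rewrite -{1}rxy -!kP => /eqP.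
exists (perm f_inj); split=> [|x|x].
- apply/permP => x; rewrite !permM !permE.
  have rsx : rho (s x) = rho x by apply: rho_eq; rewrite porbit_permS.
  rewrite (fE _ (k x).+1); last by rewrite rsx expgSr permM -kP.
  by rewrite rsx expgSr permM.
- rewrite permE (fE _ 0%N) ?expg0 ?perm1; last first.
    by apply/esym/rho_eq; rewrite rho_orb.
  by congr phi; apply: rho_eq; rewrite rho_orb.
- by rewrite permE /f mem_porbit.
Qed.

(** Used with [t] the inverse of [s], or a power of [s] generating the same cyclic group. That [c]
    fixes [x] puts it in a point stabilizer; that it preserves orbits bounds its support. *)
Lemma perm_conj_of_porbit s t x :
  (forall y, porbit t y = porbit s y) ->
  exists c : {perm T}, [/\ s * c = c * t, c x = x
    & forall y, c y \in porbit s y].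
Proof.
move=> st; have [|rho [rhoP rho_eq rhoD]] := @porbit_repr_exists s [set x].
  by move=> u v /set1P-> /set1P->.
have rho_orb y : porbit s (rho y) = porbit s y.
  by apply/eqP; rewrite eq_porbit_mem.
have [||c [sc crho corb]] := @perm_intertwiner s t rho id rhoP rho_eq.
- by move=> y; rewrite st rho_orb.
- by move=> u v; rewrite !st !rho_orb.
exists c; split=> [//||y].
  by rewrite -(rhoD x) ?set11.
by rewrite -rho_orb -st corb.
Qed.

Lemma perm_conj_of_cards s t :
  perm_eq [seq #|(B : {set T})| | B <- enum (porbits s)]
          [seq #|(B : {set T})| | B <- enum (porbits t)] ->
  exists c : {perm T}, s * c = c * t.
Proof.
move=> st; have [|rho [rhoP rho_eq _]] := @porbit_repr_exists s set0.
  by move=> u v; rewrite inE.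
have [|rho' [rhoP' rho_eq' _]] := @porbit_repr_exists t set0.
  by move=> u v; rewrite inE.
set S := enum (porbits s) in st; set S' := enum (porbits t) in st.
have memS x : porbit s x \in S by rewrite mem_enum imset_f.
(* The list [i] of indices matches each orbit of [s] with an orbit of [t] of the same size. *)
have [i i_perm SE] := perm_iotaP 0%N st.
rewrite size_map in i_perm SE.
have size_i : size i = size S' by rewrite (perm_size i_perm) size_iota.
have size_S : size S = size S'.
  by have := perm_size st; rewrite !size_map.
have [u0|[u0 _]] := set_0Vmem [set: T].
  exists 1; apply/permP => x; have := in_setT x; by rewrite u0 inE.
have ltS x : (index (porbit s x) S < size i)%N.
  by rewrite size_i -size_S index_mem.
have lti x : (nth 0%N i (index (porbit s x) S) < size S')%N.
  have: nth 0%N i (index (porbit s x) S) \in iota 0 (size S').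
    by rewrite -(perm_mem i_perm) mem_nth.
  by rewrite mem_iota.
pose O' x := nth set0 S' (nth 0%N i (index (porbit s x) S)).
have O'P x : exists y, O' x = porbit t y.
  have: O' x \in S' by rewrite mem_nth.
  by rewrite mem_enum => /imsetP[y _ ->]; exists y.
have card_O' x : #|O' x| = #|porbit s x|.
  have /(congr1 (fun r => nth 0%N r (index (porbit s x) S))) := SE.
  rewrite (nth_map set0) ?index_mem// nth_index// => ->.
  by rewrite (nth_map 0%N)// (nth_map set0).
have O'_inj x y : O' x = O' y -> porbit s x = porbit s y.
  move=> /eqP; rewrite nth_uniq ?enum_uniq// nth_uniq //; last first.
    by rewrite (perm_uniq i_perm) iota_uniq.
  by move=> /eqP /(congr1 (nth set0 S)); rewrite !nth_index.
pose phi x := odflt x [pick y in O' x].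
have phiP x : porbit t (phi x) = O' x.
  rewrite /phi; have [y Oy] := O'P x; rewrite Oy.
  case: pickP => [z|/(_ y)]; last by rewrite porbit_id.
  by rewrite -eq_porbit_mem => /eqP.
have rho_orb y : porbit s (rho y) = porbit s y.
  by apply/eqP; rewrite eq_porbit_mem.
have [|| c [sc _ _]] := @perm_intertwiner s t rho phi rhoP rho_eq.
- by move=> x; rewrite phiP card_O' rho_orb.
- by move=> x y; rewrite !phiP => /O'_inj; rewrite !rho_orb.
by exists c.
Qed.

Lemma porbitX s k x : coprime #[s] k -> porbit (s ^+ k) x = porbit s x.
Proof.
move=> cop; rewrite !porbitE; congr orbit.
by apply/esym/eqP; rewrite -[_ == _]/(generator <[s]> (s ^+ k)) generator_coprime.
Qed.

End OrbitMaps.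

(** * Square roots of permutations *)

Section SquareRoots.

Variable T : finType.
Implicit Types (s t z h : {perm T}) (x y u : T) (A B : {set T}).
Local Open Scope group_scope.

Definition sqrt_set A s : {set {perm T}} := [set h in Sym A | h * h == s].

Lemma mem_SymP A s : reflect (forall u, u \notin A -> s u = u) (s \in Sym A).
Proof.
apply: (iffP idP) => [|sid]; first by rewrite inE => sA u; apply: out_perm.
by rewrite inE; apply/subsetP => u; rewrite !inE; apply: contraR => /sid->.
Qed.

Lemma commute_permX s z i u : commute s z -> z ((s ^+ i) u) = (s ^+ i) (z u).
Proof.
move=> sz; rewrite -!permM; congr (fun_of_perm _ _).
exact/commute_sym/commuteX.
Qed.

Lemma commute_perm s z u : commute s z -> z (s u) = s (z u).
Proof. by move=> /(commute_permX 1 u); rewrite expg1. Qed.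

Lemma sqrt_commute s h : h * h = s -> commute s h.
Proof. by move<-; rewrite /commute mulgA. Qed.

Lemma card_porbit_commute s h x : commute s h -> #|porbit s (h x)| = #|porbit s x|.
Proof.
move=> sh; rewrite -[RHS](card_imset _ (@perm_inj _ h)); apply: eq_card => u.
apply/porbitP/imsetP => [[i ->]|[_ /porbitP[i ->] ->]].
  by exists ((s ^+ i) x); rewrite ?mem_porbit ?commute_permX.
by exists i; rewrite commute_permX.
Qed.

Lemma porbit_sub A s x : s \in Sym A -> x \in A -> porbit s x \subset A.
Proof.
rewrite inE => sA xA; apply/subsetP => _ /porbitP[i ->].
by elim: i => [|i IH]; rewrite ?expg0 ?perm1// expgSr permM perm_closed.
Qed.

(** This [z] is a model square root of [s] on the cycles of [x] and [y]. In the first case it acts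
    on a single cycle as [s ^+ j]; in the second it swaps two cycles of equal length. It is the
    intertwiner of [s] with itself that fixes all other representatives. *)
Lemma sqrt_perm_exists s x y :
    y \in porbit s x /\ (exists2 j, y = (s ^+ j) x & (s ^+ j) y = s x) \/
    y \notin porbit s x /\ #|porbit s y| = #|porbit s x| ->
  exists z, [/\ commute s z, z x = y, z y = s x
    & z \in Sym (porbit s x :|: porbit s y)].
Proof.
have off z (rho : T -> T) : commute s z -> (forall u, rho u \in porbit s u) ->
    (forall u, rho u != x -> rho u != y -> z (rho u) = rho u) ->
    z \in Sym (porbit s x :|: porbit s y).
  move=> sz rhoP zid; apply/mem_SymP => u; rewrite inE negb_or => /andP[ux uy].
  have /porbitP[i uE] : u \in porbit s (rho u) by rewrite porbit_sym.
  rewrite [in LHS]uE commute_permX// zid -?uE//.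
  - by apply: contraNneq ux => <-; rewrite porbit_sym.
  - by apply: contraNneq uy => <-; rewrite porbit_sym.
case=> [[xy [j yE sy]]|[xNy card_xy]].
  have [|rho [rhoP rho_eq rhoD]] := @porbit_repr_exists _ s [set x].
    by move=> u v /set1P-> /set1P->.
  have rho_orb u : porbit s (rho u) = porbit s u.
    by apply/eqP; rewrite eq_porbit_mem.
  pose phi u := if u == x then y else u.
  have phi_orb u : porbit s (phi u) = porbit s u.
    by rewrite /phi; case: eqP => // ->; apply/eqP; rewrite eq_porbit_mem.
  have [||z [sz zrho _]] := @perm_intertwiner _ s s rho phi rhoP rho_eq.
  - by move=> u; rewrite phi_orb rho_orb.
  - by move=> u v; rewrite !phi_orb !rho_orb.
  have rx : rho x = x by rewrite rhoD ?set11.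
  have zx : z x = y by rewrite -{1}rx zrho rx /phi eqxx.
  exists z; split=> //; first by rewrite {1}yE commute_permX// zx.
  by apply: (off z rho) => // u ux _; rewrite zrho /phi (negPf ux).
have [|rho [rhoP rho_eq rhoD]] := @porbit_repr_exists _ s [set x; y].
  move=> u v /set2P[]-> /set2P[]-> // /eqP; rewrite eq_porbit_mem ?(negPf xNy)//.
  by rewrite porbit_sym (negPf xNy).
have rho_orb u : porbit s (rho u) = porbit s u.
  by apply/eqP; rewrite eq_porbit_mem.
have y'x : y != x by apply: contraNneq xNy => ->; rewrite porbit_id.
pose phi u := if u == x then y else if u == y then s x else u.
have rx : rho x = x by rewrite rhoD ?set21.
have ry : rho y = y by rewrite rhoD ?set22.
have rhox u : (rho u == x) = (porbit s u == porbit s x).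
  apply/eqP/eqP => [<-|/rho_eq->//]; by rewrite rho_orb.
have rhoy u : (rho u == y) = (porbit s u == porbit s y).
  apply/eqP/eqP => [<-|/rho_eq->//]; by rewrite rho_orb.
have phi_orb u : porbit s (phi (rho u)) =
    if porbit s u == porbit s x then porbit s y
    else if porbit s u == porbit s y then porbit s x else porbit s u.
  rewrite /phi rhox rhoy; case: eqP => // _; case: eqP => _; last exact: rho_orb.
  exact: porbit_permS.
have [||z [sz zrho _]] := @perm_intertwiner _ s s rho phi rhoP rho_eq.
- move=> u; rewrite phi_orb; case: (porbit s u =P porbit s x) => [->//|_].
  by case: (porbit s u =P porbit s y) => [->|].
- move=> u v; rewrite !phi_orb.
  have xy : porbit s x <> porbit s y.
    by move/eqP; rewrite eq_porbit_mem porbit_sym (negPf xNy).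
  case: (porbit s u =P porbit s x); case: (porbit s v =P porbit s x);
  case: (porbit s u =P porbit s y); case: (porbit s v =P porbit s y);
  congruence.
exists z; split=> //.
- by rewrite -{1}rx zrho rx /phi eqxx.
- by rewrite -{1}ry zrho ry /phi (negPf y'x) eqxx.
- by apply: (off z rho) => // u ux uy; rewrite zrho /phi (negPf ux) (negPf uy).
Qed.

(** * Square roots with a prescribed value at one point *)

Section Fiber.

Variables (A : {set T}) (s z : {perm T}) (x y : T).
Hypotheses (sA : s \in Sym A) (xA : x \in A) (yA : y \in A).
Hypotheses (sz : commute s z) (zx : z x = y) (zy : z y = s x).
Let B := porbit s x :|: porbit s y.
Hypothesis zB : z \in Sym B.

Let sub_BA : B \subset A.
Proof. by rewrite subUset !porbit_sub. Qed.

Let BP u : u \in B -> exists i, u = (s ^+ i) x \/ u = (s ^+ i) y.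
Proof. by case/setUP => /porbitP[i ->]; exists i; [left | right]. Qed.

(** This is [s] with the cycles of [x] and [y] erased, since [z] squares to [s] on [B] and is the
    identity elsewhere. *)
Let s' := s * (z * z)^-1.

Let zz_on u : u \in B -> z (z u) = s u.
Proof.
have ssi i v : (s ^+ i) (s v) = s ((s ^+ i) v) by rewrite -!permM -expgS -expgSr.
move=> /BP[i [->|->]]; rewrite !(commute_permX _ _ sz); first by rewrite zx zy ssi.
by rewrite zy (commute_perm _ sz) zx ssi.
Qed.

Lemma sqrt_residue_Sym : s' \in Sym (A :\: B).
Proof.
apply/mem_SymP => u; rewrite !inE negb_and negbK => uAB.
rewrite permM; apply: (canLR (permK _)); rewrite permM.
have [uB|uNB] := boolP (u \in B); first by rewrite zz_on.
have uNA : u \notin A by move: uAB; rewrite -in_setU -/B (negPf uNB).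
by rewrite (mem_SymP _ _ sA)// !(mem_SymP _ _ zB).
Qed.

Lemma sqrt_residue_out u : u \notin B -> s' u = s u.
Proof.
move=> uB; rewrite permM; apply: (canLR (permK _)); rewrite permM.
by rewrite !(commute_perm _ sz) (mem_SymP _ _ zB)// (mem_SymP _ _ zB).
Qed.

Lemma porbit_sqrt_residue u : u \notin B -> porbit s' u = porbit s u.
Proof.
move=> uB; have XE i : (s' ^+ i) u = (s ^+ i) u /\ (s ^+ i) u \notin B.
  elim: i => [|i [IH iB]]; first by rewrite !expg0 !perm1.
  rewrite !expgSr (permM (s' ^+ i)) (permM (s ^+ i)) IH sqrt_residue_out//; split=> //.
  move: iB; rewrite !inE -!eq_porbit_mem porbit_permS.
  by rewrite !eq_porbit_mem.
by apply/setP => v; apply/porbitP/porbitP => -[i ->]; exists i; case: (XE i).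
Qed.

Lemma porbits_sqrt_residue :
  porbit s' @: (A :\: B) = porbit s @: A :\ porbit s x :\ porbit s y.
Proof.
apply/setP => X; apply/imsetP/idP => [[u /setDP[uA uB] ->]|].
  rewrite porbit_sqrt_residue// !inE imset_f// !eq_porbit_mem.
  by move: uB; rewrite inE negb_or => /andP[-> ->].
rewrite !inE => /and3P[Xy Xx /imsetP[u uA XE]].
have uB : u \notin B by rewrite inE -!eq_porbit_mem -XE negb_or Xx Xy.
by exists u; rewrite ?porbit_sqrt_residue// !inE uA andbT -in_setU.
Qed.

(** A root [h] with [h x = y] sends [y] to [s x]; as it commutes with [s], it agrees with [z] on all
    of [B]. Hence [k |-> k * z] maps the roots of [s'] supported off [B] bijectively onto the
    fiber. *)
Lemma card_sqrt_fiber :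
  #|[set h in sqrt_set A s | h x == y]| = #|sqrt_set (A :\: B) s'|.
Proof.
have SymS (C : {set T}) : C \subset A -> {subset Sym C <= Sym A}.
  move=> CA h /mem_SymP hC; apply/mem_SymP => u uA; apply: hC.
  by apply: contra uA; apply: subsetP.
rewrite -(card_imset (mem (sqrt_set (A :\: B) s')) (mulIg z)).
apply: eq_card => h.
rewrite [LHS]inE; apply/andP/imsetP => [[]|[k]]; rewrite inE => /andP[].
  move=> hA /eqP hh /eqP hx; have sh := sqrt_commute hh.
  have hy : h y = s x by rewrite -hx -permM hh.
  have hB u : u \in B -> h u = z u.
    by move=> /BP[i [->|->]]; rewrite !commute_permX// ?hx ?zx ?hy ?zy.
  have zB' u : u \in B -> z u \in B by rewrite perm_closed//; move: zB; rewrite inE.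
  have kz : commute h z.
    apply/permP => u; rewrite !permM.
    have [uB|uNB] := boolP (u \in B); first by rewrite !hB ?zB'.
    rewrite [in RHS](mem_SymP _ _ zB)// (mem_SymP _ _ zB)//.
    apply: contra uNB => huB; have: h (h u) \in B by rewrite hB ?zB'.
    by rewrite -permM hh !inE -!eq_porbit_mem porbit_permS.
  exists (h * z^-1); last by rewrite mulgKV.
  rewrite inE; apply/andP; split; last first.
    have {}kz : commute (h * z^-1) h.
      by apply: commute_sym; apply: commuteM => //; apply: commuteV.
    by rewrite mulgA kz mulgA hh -mulgA -invMg.
  apply/mem_SymP => u; rewrite inE negb_and negbK permM => /orP[uB|uNA].
    by rewrite hB// permK.
  rewrite (mem_SymP _ _ hA)//; apply: (canLR (permK _)).
  by rewrite (mem_SymP _ _ zB)//; apply: contra uNA; apply: subsetP.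
move=> kAB /eqP kk ->; have kz : commute k z.
  apply: perm_onC (_ : perm_on (A :\: B) k) (_ : perm_on B z) _.
  - by move: kAB; rewrite inE.
  - by move: zB; rewrite inE.
  - by rewrite -setI_eq0 setIDAC setDIl setDv setI0.
split.
  rewrite inE groupM ?(SymS _ (subsetDl _ _) _ kAB) ?(SymS _ sub_BA _ zB)//=.
  by rewrite mulgA -(mulgA k z) -kz mulgA kk -!mulgA mulVg mulg1 eqxx.
by rewrite permM (mem_SymP _ _ kAB) ?zx// !inE porbit_id.
Qed.

End Fiber.

Lemma perm_enum_setD1 (U : finType) (P : {set U}) X : X \in P ->
  perm_eq (enum P) (X :: enum (P :\ X)).
Proof.
move=> XP; apply: uniq_perm; rewrite /= ?enum_uniq ?mem_enum ?setD11//.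
by move=> Y; rewrite inE !mem_enum !inE; case: eqP => // ->.
Qed.

(** * Counting square roots by recursion on the cycle lengths *)

Section Count.

Variables (K : pzSemiRingType) (W : seq nat -> K).
Hypothesis W_perm : forall a b, perm_eq a b -> W a = W b.
Hypothesis W_nil : W [::] = 1%R.
Hypothesis W_cons : forall m De, (0 < m)%N ->
  W (m :: De) =
    ((odd m)%:R * W De + (m * count_mem m De)%:R * W (rem m De))%R.

(* A square root of [s] either preserves the cycle of [s] through a given     *)
(* point, which must then have odd length, or swaps it with another cycle of  *)
(* the same length [m], in [m] ways.                                          *)
Lemma card_sqrt_set A s : s \in Sym A ->
  #|sqrt_set A s|%:R =
    W [seq #|(X : {set T})| | X <- enum [set porbit s u | u in A]].
Proof.
have [n] := ubnP #|A|; elim: n A s => // n IH A s ltAn sA.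
have [A0|[x xA]] := set_0Vmem A.
  have s1 : s = 1 by apply/permP => u; rewrite perm1 (mem_SymP _ _ sA)// A0 inE.
  rewrite A0 imset0 enum_set0 W_nil (_ : sqrt_set _ _ = [set 1]) ?cards1//.
  apply/setP => h; rewrite !inE s1; apply/andP/eqP => [[hA _]|->].
    by apply/permP => u; rewrite perm1 (out_perm hA) ?inE.
  by rewrite perm_on1 mulg1.
set P := [set porbit s u | u in A]; set O := porbit s x; pose m := #|O|.
have OP : O \in P by apply: imset_f.
have m_gt0 : (0 < m)%N by rewrite lt0n card_porbit_neq0.
pose cards (Q : {set {set T}}) := [seq #|(X : {set T})| | X <- enum Q].
pose r := cards (P :\ O).
have cardsD1 (Q : {set {set T}}) X : X \in Q ->
    perm_eq (cards (Q :\ X)) (rem #|X| (cards Q)).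
  move=> XQ; have Qeq := perm_map (fun X : {set T} => #|X|) (perm_enum_setD1 XQ).
  have XQ' : #|X| \in cards Q by rewrite (perm_mem Qeq) mem_head.
  by rewrite -(perm_cons #|X|) -(permPl Qeq) perm_to_rem.
have WP : W (cards P) = W (m :: r).
  by apply: W_perm; rewrite (perm_map _ (perm_enum_setD1 OP)).
have fiber y : y \in A ->
    y \in O /\ (exists2 j, y = (s ^+ j) x & (s ^+ j) y = s x) \/
    y \notin O /\ #|porbit s y| = m ->
    #|[set h in sqrt_set A s | h x == y]|%:R = W (cards (P :\ O :\ porbit s y)).
  move=> yA Hy; have [z [sz zx zy zB]] := sqrt_perm_exists Hy.
  rewrite (card_sqrt_fiber sA xA yA sz zx zy zB) IH.
  - by rewrite porbits_sqrt_residue.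
  - rewrite (leq_trans _ (_ : #|A| <= n)%N)//; apply: proper_card.
    apply/properP; split; first exact: subsetDl.
    by exists x => //; rewrite !inE porbit_id.
  - exact: sqrt_residue_Sym.
(* Conversely, [h x] either lies in [O], where [h (h x) = s x] constrains its exponent [j], or lies
   in another cycle of length [m], because [h] commutes with [s]. All other fibers are empty. *)
have fiber0 y h : h \in [set h in sqrt_set A s | h x == y] ->
    y \in O /\ (exists2 j, y = (s ^+ j) x & (s ^+ j) y = s x) \/
    y \notin O /\ #|porbit s y| = m.
  rewrite !inE => /andP[/andP[hA /eqP hh] /eqP <-].
  have sh := sqrt_commute hh.
  have [hxO|hxO] := boolP (h x \in O); [left|right]; split=> //.
    have /porbitP[j hxE] := hxO; exists j => //.
    by rewrite -commute_permX// -hxE -permM hh.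
  exact: card_porbit_commute.
pose F y := [set h in sqrt_set A s | h x == y].
have F0 y : ~ (y \in O /\ (exists2 j, y = (s ^+ j) x & (s ^+ j) y = s x) \/
    y \notin O /\ #|porbit s y| = m) -> #|F y|%:R = 0%R :> K.
  move=> Ny; rewrite (_ : F y = set0) ?cards0//.
  by apply/eqP/negPn/negP => /set0Pn[h /fiber0].
have -> : #|sqrt_set A s|%:R = (\sum_(y in A) #|F y|%:R)%R :> K.
  rewrite -natr_sum; congr _%:R%R.
  rewrite -sum1_card (partition_big (fun h : {perm T} => h x) (mem A)) /=.
    by apply: eq_bigr => y _; rewrite -sum1_card; apply: eq_bigl => h; rewrite !inE.
  by move=> h; rewrite !inE => /andP[hA _]; rewrite perm_closed.
have O_A := porbit_sub sA xA.
(* Inside [O] the exponent is a half of 1 modulo [m]: there is none for [m] even, and only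
   [(m + 1) / 2] for [m] odd. *)
have two_j y j : y = (s ^+ j) x -> (s ^+ j) y = s x -> (j + j == 1 %[mod m])%N.
  by move=> -> sj; rewrite -eq_permX_porbit expgD permM sj expg1.
rewrite WP W_cons// (bigID (mem O)) /=; congr (_ + _)%R.
  have [m_odd|m_even] := boolP (odd m); last first.
    rewrite mul0r big1// => y /andP[_ yO]; apply: F0 => -[[_ [j yE sj]]|[]].
      have /eqP/(congr1 odd) := two_j _ _ yE sj.
      by rewrite !odd_mod ?(negPf m_even)// addnn odd_double.
    by rewrite yO.
  pose y0 := (s ^+ (m.+1)./2) x.
  have dbl : (m.+1./2 + m.+1./2 = m.+1)%N by rewrite addnn even_halfK//= m_odd.
  have y0O : y0 \in O by apply: mem_porbit.
  rewrite (bigD1 y0) ?y0O ?(subsetP O_A)//= fiber ?(subsetP O_A)//; last first.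
    left; split=> //; exists (m.+1)./2 => //.
    by rewrite -permM -expgD dbl expgSr permM permX iter_porbit.
  rewrite porbit_perm -/O setDDl setUid -/r big1 ?addr0 ?mul1r//.
  move=> y /andP[/andP[_ yO] yy0]; apply: F0 => -[[_ [j yE sj]]|[]]; last first.
    by rewrite yO.
  case/negP: yy0; rewrite yE /y0 eq_permX_porbit -/O -/m.
  have /eqP jj := two_j _ _ yE sj.
  by rewrite -(modnMDl j) addnC -mulnS -dbl mulnDr -mulnDl -modnMml jj modnMml mul1n dbl.
(* Outside [O], each point of a cycle of length [m] contributes the same count, that of [s] with two
   cycles of length [m] erased; there are [m] such points per cycle. *)
rewrite (bigID (fun y => #|porbit s y| == m)) /= [X in (_ + X)%R]big1 ?addr0; last first.
  move=> y /andP[/andP[_ yO] ym]; apply: F0 => -[[]|[_ /eqP]].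
    by rewrite (negPf yO).
  by rewrite (negPf ym).
rewrite (eq_bigr (fun=> W (rem m r))) => [|y /andP[/andP[yA yO] /eqP ym]]; last first.
  rewrite fiber//; last by right.
  apply: W_perm; rewrite -ym; apply: cardsD1.
  by rewrite !inE imset_f// eq_porbit_mem andbT.
rewrite big_const iter_addr_0 -[LHS]mulr_natl; congr (_%:R * _)%R.
rewrite -sum1_card (partition_big (porbit s)
  (fun X => (X \in P :\ O) && (#|X| == m))) /=; last first.
  move=> y /andP[/andP[yA yO] ->].
  by rewrite !inE imset_f// eq_porbit_mem yO.
rewrite (eq_bigr (fun=> m)) => [|X /andP[]]; last first.
  rewrite !inE => /andP[XO /imsetP[u uA XE]] /eqP Xm.
  rewrite -Xm -[in RHS]sum1_card; apply: eq_bigl => y.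
  rewrite [RHS](_ : _ = (porbit s y == X)); last by rewrite XE eq_porbit_mem.
  apply/andP/idP => [[]//|/eqP yX]; split; last exact/eqP.
  change (is_true ((y \in A) && (y \notin O) && (#|porbit s y| == #|X|))).
  rewrite yX eqxx andbT.
  rewrite -eq_porbit_mem yX XO andbT; apply: (subsetP (porbit_sub sA uA)).
  by rewrite -eq_porbit_mem yX XE.
rewrite -big_enum_cond big_const_seq iter_addn_0; congr (_ * _)%N.
by rewrite count_map; apply: eq_count.
Qed.

End Count.

End SquareRoots.

(** * Frobenius-Schur indicators *)

Section FrobeniusSchur.

Variable gT : finGroupType.
Implicit Types (G H : {group gT}) (g h x : gT).

Definition fs_indicator G (phi : 'CF(G)) : algC :=
  #|G|%:R^-1 * \sum_(g in G) phi (g * g)%g.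

(** Write [E = c r] with [c] left invertible and [r] right invertible. Cancelling both in
    [c r c r = c r] gives [r c = 1], of size the rank, and [c r] and [r c] have the same trace. *)
Lemma mxtrace_idempotent (F : fieldType) n (E : 'M[F]_n) :
  E *m E = E -> \tr E = (\rank E)%:R.
Proof.
move=> EE; move: (mulmxVp (row_base_free E)) (mulVpmx (col_base_full E)).
move: (mulmx_base E).
move: (col_base E) (row_base E) (pinvmx _) (pinvmx _).
move: (\rank E) => k c r c' r' crE rV cV.
suff rc : r *m c = 1%:M by rewrite -[in LHS]crE mxtrace_mulC rc mxtrace1.
have -> : r *m c = c' *m (c *m r *m (c *m r)) *m r'.
  by rewrite !mulmxA cV mul1mx -!mulmxA rV mulmx1.
by rewrite crE EE -crE mulmxA cV mul1mx.
Qed.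

Lemma mxtrace_lin_mx (R : comNzRingType) m n (f : {linear 'M[R]_(m, n) -> 'M[R]_(m, n)}) :
  \tr (lin_mx f) = \sum_i \sum_j f (delta_mx i j) i j.
Proof.
rewrite /mxtrace pair_bigA /= (reindex _ (curry_mxvec_bij m n)) /=.
apply: eq_bigr => -[i j] _ /=.
by rewrite !mxE /= vec_mx_delta mxvecE.
Qed.

Lemma cfdot_irr_conj_le1 G (i : Iirr G) :
  #|G|%:R^-1 * \sum_(g in G) 'chi_i g ^+ 2 <= 1.
Proof.
have -> : #|G|%:R^-1 * \sum_(g in G) 'chi_i g ^+ 2 = '['chi_i, 'chi_(conjC_Iirr i)].
  rewrite cfdotE; congr (_ * _); apply: eq_bigr => g _.
  by rewrite conjC_IirrE cfunE conjCK.
by rewrite cfdot_irr; case: eqP => _; rewrite ?ler01.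
Qed.

(* On matrices [X], the average of [X |-> rho(g) X rho(g)^T] is an idempotent *)
(* of trace at most 1 commuting with transposition, so its antisymmetric part *)
(* is an idempotent too; the trace of the latter is a natural number.         *)
Lemma fs_indicator_le1 G (i : Iirr G) : fs_indicator 'chi_i <= 1.
Proof.
have [rG _ chiE] := irr_reprP (mem_irr i).
case: rG chiE => n rG /= chiE.
pose K g : 'M[algC]_(n * n) := lin_mx (mulmxr (rG g)^T \o mulmx (rG g)).
pose S : 'M[algC]_(n * n) := lin_mx trmx.
pose c : algC := #|G|%:R^-1.
have c0 : #|G|%:R != 0 :> algC by rewrite neq0CG.
pose M := c *: \sum_(g in G) K g.
(* The order is reversed because [lin_mx] acts on row vectors from the right. *)
have KK : {in G &, forall g h, K g *m K h = K (h * g)%g}.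
  move=> g h gG hG; apply/row_matrixP => k; rewrite !rowE.
  rewrite mulmxA !mul_rV_lin /= mxvecK; congr mxvec.
  by rewrite repr_mxM// trmx_mul !mulmxA.
have SS : S *m S = 1%:M.
  apply/row_matrixP => k; rewrite !rowE mulmxA !mul_rV_lin /= mxvecK trmxK.
  by rewrite vec_mxK mulmx1.
have KS g : K g *m S = S *m K g.
  apply/row_matrixP => k; rewrite !rowE !mulmxA !mul_rV_lin /= !mxvecK.
  by rewrite !trmx_mul trmxK mulmxA.
have MM : M *m M = M.
  rewrite /M -scalemxAl -scalemxAr mulmx_suml scalerA.
  rewrite (eq_bigr (fun=> \sum_(h in G) K h)) => [|g gG]; last first.
    rewrite mulmx_sumr (eq_bigr (fun h => K (h * g)%g)) => [|h hG]; last exact: KK.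
    rewrite [RHS](reindex_inj (mulIg g)) /=; apply: eq_bigl => h.
    by rewrite groupMr.
  by rewrite sumr_const -scaler_nat scalerA -mulrA mulVf// mulr1.
have MS : M *m S = S *m M.
  rewrite /M -scalemxAl -scalemxAr mulmx_suml mulmx_sumr.
  by congr (_ *: _); apply: eq_bigr.
have MSM : M *m S *m M = M *m S by rewrite -mulmxA -MS mulmxA MM.
have MSMS : M *m S *m (M *m S) = M by rewrite mulmxA MSM -mulmxA SS mulmx1.
pose E := 2^-1 *: (M - M *m S).
have EE : E *m E = E.
  have NN : (M - M *m S) *m (M - M *m S) = (M - M *m S) *+ 2.
    by rewrite mulmxBl !mulmxBr MM MSMS MSM mulmxA MM opprB mulr2n.
  rewrite /E -scalemxAl -scalemxAr NN scalerA -scaler_nat scalerA.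
  by rewrite -mulrA mulVf ?mulr1// pnatr_eq0.
have trK g : g \in G -> \tr (K g) = 'chi_i g ^+ 2.
  move=> gG; rewrite mxtrace_lin_mx chiE cfunE gG /= mulr1n expr2 mulr_suml.
  apply: eq_bigr => k _; rewrite mulr_sumr; apply: eq_bigr => l _.
  rewrite mxE (bigD1 l)//= big1 ?addr0 => [|l' ll']; last first.
    rewrite mxE (bigD1 k)//= big1 ?addr0 => [|k' kk']; last first.
      by rewrite [delta_mx _ _ _ _]mxE (negPf kk') mulr0.
    by rewrite [delta_mx _ _ _ _]mxE eqxx (negPf ll') mulr0 mul0r.
  rewrite !mxE (bigD1 k)//= big1 ?addr0 => [|k' kk']; last first.
    by rewrite [delta_mx _ _ _ _]mxE (negPf kk') mulr0.
  by rewrite [delta_mx _ _ _ _]mxE !eqxx mulr1.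
have trKS g : g \in G -> \tr (K g *m S) = 'chi_i (g * g)%g.
  move=> gG.
  have -> : K g *m S = lin_mx (trmx \o (mulmxr (rG g)^T \o mulmx (rG g))).
    by apply/row_matrixP => k; rewrite !rowE !mulmxA !mul_rV_lin /= !mxvecK.
  rewrite mxtrace_lin_mx chiE cfunE groupM// mulr1n repr_mxM//.
  apply: eq_bigr => k _; rewrite mxE; apply: eq_bigr => l _.
  rewrite !mxE (bigD1 l)//= big1 ?addr0 => [|l' ll']; last first.
    rewrite mxE (bigD1 k)//= big1 ?addr0 => [|k' kk']; last first.
      by rewrite [delta_mx _ _ _ _]mxE (negPf kk') mulr0.
    by rewrite [delta_mx _ _ _ _]mxE eqxx (negPf ll') mulr0 mul0r.
  rewrite !mxE (bigD1 k)//= big1 ?addr0 => [|k' kk']; last first.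
    by rewrite [delta_mx _ _ _ _]mxE (negPf kk') mulr0.
  by rewrite [delta_mx _ _ _ _]mxE !eqxx mulr1 mulrC.
have trM : \tr M = c * \sum_(g in G) 'chi_i g ^+ 2.
  by rewrite mxtraceZ raddf_sum; congr (_ * _); apply: eq_bigr.
have trMS : \tr (M *m S) = fs_indicator 'chi_i.
  rewrite -scalemxAl mxtraceZ mulmx_suml raddf_sum; congr (_ * _).
  by apply: eq_bigr.
(* Half of [tr M - tr (M S)] is a rank, hence nonnegative; so the indicator [tr (M S)] is at most
   [tr M], the product of ['chi_i] with its conjugate. *)
have := mxtrace_idempotent EE; rewrite mxtraceZ raddfB /= trM trMS => trE.
apply: le_trans (cfdot_irr_conj_le1 i); rewrite -subr_ge0.
have := ler0n algC (\rank E); rewrite -trE pmulr_rge0//.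
by rewrite invr_gt0 ltr0n.
Qed.

End FrobeniusSchur.

(** * Groups whose elements are inverted by elements of a subgroup *)

Section RealOrbits.

Variable gT : finGroupType.
Implicit Types (G H : {group gT}) (g h x : gT).

Lemma sqrt_count_is_class_fun G :
  is_class_fun <<G>>%g
    [ffun g => if g \in G then #|[set h in G | (h * h)%g == g]|%:R else 0 : algC].
Proof.
apply: intro_class_fun => [x y|x]; rewrite /= genGid; last by move/negPf->.
move=> xG yG; rewrite groupJr// xG; congr _%:R; rewrite -[RHS](card_imset _ (conjg_inj y)).
apply: eq_card => h; rewrite !inE; apply/andP/imsetP => [[hG /eqP hh]|[k]].
  exists (h ^ y^-1)%g; last by rewrite conjgKV.
  by rewrite inE groupJ ?groupV//= -conjMg hh conjgK eqxx.
by rewrite inE => /andP[kG /eqP kk] ->; rewrite groupJ//= -conjMg kk.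
Qed.

Definition sqrt_count G : 'CF(G) := Cfun 0 (sqrt_count_is_class_fun G).

Lemma sqrt_countE G g : g \in G ->
  sqrt_count G g = #|[set h in G | (h * h)%g == g]|%:R.
Proof. by move=> gG; rewrite cfunElock gG. Qed.

Lemma sum_sqrt_count G (phi : gT -> algC) :
  \sum_(g in G) sqrt_count G g * phi g = \sum_(h in G) phi (h * h)%g.
Proof.
rewrite [RHS](partition_big (fun h => h * h)%g (mem G)) /=; last first.
  by move=> h hG; rewrite groupM.
apply: eq_bigr => g gG; rewrite sqrt_countE// -sum1_card natr_sum mulr_suml.
apply: eq_big => h; rewrite ?inE// => /andP[_ /eqP->]; by rewrite mul1r.
Qed.

Lemma cfdot_sqrt_count_irr G (i : Iirr G) :
  '[sqrt_count G, 'chi_i] = (fs_indicator 'chi_i)^*.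
Proof.
rewrite cfdotE sum_sqrt_count /fs_indicator rmorphM fmorphV rmorph_nat.
by rewrite rmorph_sum.
Qed.

(** In [algC] a number comparable with a real one is real, so the bound by 1 suffices. *)
Lemma fs_indicator_conj G (i : Iirr G) :
  (fs_indicator 'chi_i)^* = fs_indicator 'chi_i.
Proof.
by apply/CrealP; rewrite (ler_real (fs_indicator_le1 i)) rpred1.
Qed.

(** Put [g = k x]: then [g ^ 2 = k ^ 2] says that [k] inverts [x]. For fixed [x] the elements of [H]
    inverting [x] form a coset of ['C_H[x]], nonempty by hypothesis, so both sides count commuting
    pairs in [G] and [H]. *)
Lemma card_real_orbit_pairs G H : H \subset G ->
    {in G, forall x, exists2 k, k \in H & (x ^ k = x^-1)%g} ->
  (\sum_(k in H) #|[set g in G | (g * g == k * k)%g]| =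
   \sum_(h in H) #|'C_G[h]%g|)%N.
Proof.
move=> sHG realG; transitivity (\sum_(x in G) #|[set k in H | (x ^ k == x^-1)%g]|)%N.
  transitivity (\sum_(k in H) #|[set x in G | (x ^ k == x^-1)%g]|)%N.
    apply: eq_bigr => k kH; have kG := subsetP sHG _ kH.
    have eqE x : (k * x * (k * x) == k * k = (x ^ k == x^-1))%g.
      rewrite -mulgA (inj_eq (mulgI k)) mulgA -(inj_eq (mulIg x^-1)%g) mulgK.
      by rewrite conjgE -(inj_eq (mulgI k) (_^-1 * _)%g) mulKVg.
    rewrite -[RHS](card_imset _ (mulgI k)); apply: eq_card => g.
    apply/idP/imsetP => [|[x + ->]]; last first.
      by rewrite !inE eqE => /andP[xG ->]; rewrite groupM.
    rewrite inE => /andP[gG gg]; exists (k^-1 * g)%g; last by rewrite mulKVg.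
    by rewrite inE groupM ?groupV//= -eqE mulKVg.
  under eq_bigr do rewrite -sum1dep_card; under [RHS]eq_bigr do rewrite -sum1dep_card.
  rewrite (exchange_big_dep (mem G)) => [|k x _ /andP[]//].
  by apply: eq_bigr => x xG; apply: eq_bigl => k; rewrite (_ : x \in G)//.
transitivity (\sum_(x in G) #|'C_H[x]%g|)%N.
  apply: eq_bigr => x /realG[k kH xk]; rewrite -[RHS](card_imset _ (mulIg k)).
  apply: eq_card => h; apply/idP/imsetP => [|[y + ->]].
    rewrite inE => /andP[hH /eqP xh]; exists (h * k^-1)%g; last by rewrite mulgKV.
    rewrite inE groupM ?groupV//=; apply/cent1P/commute_sym/commgP/conjg_fixP.
    by rewrite conjgM xh -xk conjgK.
  case/setIP=> yH /cent1P yx.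
  have xy : (x ^ y = x)%g by apply/conjg_fixP/commgP/commute_sym.
  by rewrite inE groupM//= conjgM xy xk.
have cE (A : {set gT}) x : #|'C_A[x]%g| = (\sum_(y in A | y \in 'C[x]%g) 1)%N.
  by rewrite -sum1_card; apply: eq_bigl => y; rewrite inE.
under eq_bigr do rewrite cE; under [RHS]eq_bigr do rewrite cE.
rewrite (exchange_big_dep (mem H)) => [|x h _ /andP[]//].
by apply: eq_bigr => h hH; apply: eq_bigl => x; rewrite (_ : h \in H)// cent1C.
Qed.

(** This is column orthogonality in [G], summed over the elements of [H]. *)
Lemma sum_cfnorm_Res G H : H \subset G ->
  \sum_(i : Iirr G) '['Res[H] 'chi_i] = #|H|%:R^-1 * (\sum_(h in H) #|'C_G[h]%g|)%N%:R.
Proof.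
move=> sHG; under [LHS]eq_bigr do rewrite cfdotE; rewrite -mulr_sumr natr_sum.
congr (_ * _); rewrite exchange_big; apply: eq_bigr => h hH.
have hG := subsetP sHG _ hH.
under [LHS]eq_bigr do rewrite !cfResE//.
by rewrite second_orthogonality_relation// class_refl.
Qed.

(* Both sides of the identity between sums of squares of restriction          *)
(* multiplicities and indicators count the [H]-classes of [G], by             *)
(* [card_real_orbit_pairs].                                                   *)
Lemma fs_indicator_real_orbits G H : H \subset G ->
    {in G, forall x, exists2 k, k \in H & (x ^ k = x^-1)%g} ->
    (forall j : Iirr H, fs_indicator 'chi_j = 1) ->
  forall i : Iirr G, fs_indicator 'chi_i = 1.
Proof.
move=> sHG realG fsH; pose m (i : Iirr G) (j : Iirr H) := '['Res[H] 'chi_i, 'chi_j].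
have mN i j : m i j \in Num.nat by rewrite Cnat_cfdot_char_irr ?cfRes_char ?irr_char.
have m_real i j : (m i j)^* = m i j by apply/CrealP/Rreal_nat/mN.
have sq : \sum_i \sum_j m i j ^+ 2 = \sum_i \sum_j fs_indicator 'chi_i * m i j.
  transitivity (\sum_(i : Iirr G) '['Res[H] 'chi_i]).
    apply: eq_bigr => i _; rewrite cfdot_sum_irr; apply: eq_bigr => j _.
    by rewrite -/(m i j) m_real expr2.
  rewrite sum_cfnorm_Res// -card_real_orbit_pairs//.
  (* Summed over the square roots in [H], this product counts the pairs of [card_real_orbit_pairs];
     expanded in irreducible characters, it yields the indicators. *)
  transitivity '['Res[H] (sqrt_count G), sqrt_count H].
    rewrite cfdotC cfdotE rmorphM fmorphV rmorph_nat; congr (_ * _).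
    rewrite sum_sqrt_count natr_sum [RHS]rmorph_sum; apply: eq_bigr => k kH /=.
    by rewrite conjCK cfResE ?groupM// sqrt_countE// groupM ?(subsetP sHG).
  rewrite {1}(cfun_sum_cfdot (sqrt_count G)) linear_sum cfdot_suml.
  apply: eq_bigr => i _; rewrite cfdot_sum_irr; apply: eq_bigr => j _.
  rewrite cfdot_sqrt_count_irr linearZ cfdotZl -/(m i j) fs_indicator_conj.
  by rewrite cfdot_sqrt_count_irr fsH conjCK mulr1.
(* Nonnegative terms with sum 0 all vanish; a nonzero multiplicity then equals the indicator, which
   is therefore at least 1. *)
have term_ge0 i j : 0 <= m i j ^+ 2 - fs_indicator 'chi_i * m i j.
  have [k ->] : exists k, m i j = k%:R by apply/natrP.
  apply: (@le_trans _ _ (k%:R ^+ 2 - 1 * k%:R)).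
    by rewrite mul1r subr_ge0 -natrX ler_nat; case: k => // k; rewrite leq_pmulr.
  by rewrite lerB// ler_wpM2r ?ler0n ?fs_indicator_le1.
move=> i; have [j m_neq0] : exists j, m i j != 0.
  have Res_neq0 : 'Res[H] 'chi_i != 0.
    by apply: contraNneq (irr1_neq0 i) => Res0; rewrite -(cfRes1 H) Res0 cfunE.
  by have [j] := neq0_has_constt Res_neq0; rewrite irr_consttE; exists j.
have /eqP : \sum_i \sum_j (m i j ^+ 2 - fs_indicator 'chi_i * m i j) = 0.
  by under eq_bigr do rewrite sumrB; rewrite sumrB sq subrr.
rewrite psumr_eq0 => [|i' _]; last by apply: sumr_ge0.
move=> /allP/(_ i); rewrite mem_index_enum => /(_ isT); rewrite psumr_eq0//.
move=> /allP/(_ j); rewrite mem_index_enum => /(_ isT) /=.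
rewrite subr_eq0 expr2 => /eqP/(mulIf m_neq0) mE.
apply/le_anti; rewrite fs_indicator_le1 -mE.
have [k kE] : exists k, m i j = k%:R by apply/natrP.
by rewrite kE ler1n lt0n -(pnatr_eq0 algC) -kE.
Qed.

End RealOrbits.

(** * Indicators of symmetric groups *)

Section Sym.

Variable T : finType.

(** Induction on [A] through the stabilizer of a point [x]: a permutation and its inverse have the
    same orbits, so a permutation fixing [x] conjugates one to the other. *)
Lemma fs_indicator_Sym (A : {set T}) (G : {group {perm T}}) :
  G :=: Sym A -> forall i : Iirr G, fs_indicator 'chi_i = 1.
Proof.
have [n] := ubnP #|A|; elim: n A G => // n IH A G ltAn GA.
have [A0|[x xA]] := set_0Vmem A.
  have G1 : G :=: 1%g.
    apply/trivgP/subsetP => s; rewrite GA A0 inE => sA; rewrite inE.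
    by apply/eqP/permP => u; rewrite perm1 (out_perm sA) ?inE.
  have cG : cyclic G by rewrite G1 cyclic1.
  have cG1 : #|G| = 1%N by rewrite G1 cards1.
  move=> i; rewrite /fs_indicator cG1 invr1 mul1r (big_pred1 1%g) ?mulg1 => [|g].
    by rewrite lin_char1// irr_cyclic_lin.
  by rewrite G1 !inE.
apply: (@fs_indicator_real_orbits _ G [group of Sym (A :\ x)]).
- rewrite GA; apply/subsetP => s; rewrite !inE => sA.
  by apply: subset_trans sA (subsetDl _ _).
- move=> s; rewrite GA => sA.
  have [c [sc cx cs]] := @perm_conj_of_porbit _ s s^-1 x (porbitV s).
  exists c; last by rewrite conjgE sc mulKg.
  apply/mem_SymP => u; rewrite !inE negb_and negbK => /orP[/eqP->//|uA].
  have /porbitP[i ->] := cs u.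
  elim: i => [|i IHi]; rewrite ?expg0 ?perm1// expgSr permM IHi.
  by rewrite (mem_SymP _ _ sA).
- apply: IH => //; rewrite (leq_trans _ (_ : #|A| <= n)%N)//.
  by rewrite (cardsD1 x A) xA.
Qed.

End Sym.

(** * Characters of the symmetric group *)

(* A Galois conjugate of [chi g] is [chi (g ^+ k)] with [k] prime to the      *)
(* order of [g].                                                              *)
Lemma char_rational_class_int (gT : finGroupType) (G : {group gT}) (chi : 'CF(G)) g :
    chi \is a character -> g \in G ->
    (forall k, coprime #[g]%g k -> (g ^+ k)%g \in (g ^: G)%g) ->
  chi g \is a Num.int.
Proof.
move=> Nchi gG rat_g; apply: Cint_rat_Aint; last exact: Aint_char.
pose n := #[g]%g.
have [Qn galQn [QnC gQnC [eps [pr_eps defQn] QnG]]] :=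
  group_num_field_exists <[g]>%G.
rewrite -orderE -/n in pr_eps.
have [a aE] := QnG _ G _ Nchi g (dvdnn _).
have sgG : <[g]>%g \subset G by rewrite cycle_subG.
have gg : g \in <[g]>%g by rewrite cycle_id.
(* An algebraic integer is an integer once it is rational, that is, fixed by the Galois group. *)
suff /vlineP[r ar] : a \in (1%VS : {vspace Qn}).
  by rewrite -aE ar rmorphZ_num rmorph1 mulr1 Crat_rat.
move/galois_fixedField: galQn => <-; apply/fixedFieldP; rewrite ?memvf// => nu nuG.
have [nuC nuCE] := gQnC nu; apply: (fmorph_inj QnC); rewrite nuCE aE.
have pr_nu : n.-primitive_root (nu eps) by rewrite fmorph_primitive_root.
have [k nu_eps] := prim_rootP pr_eps (prim_expr_order pr_nu).
have cop : coprime n k by rewrite coprime_sym -(prim_root_exp_coprime _ pr_eps) -nu_eps.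
have /imsetP[y yG gkE] := rat_g _ cop.
have res h : h \in <[g]>%g -> chi h = 'Res[<[g]>%g] chi h by move=> hg; rewrite cfResE.
rewrite -[RHS](cfunJ chi g yG) -gkE.
(* On the cyclic group the restriction is a sum of linear characters, whose values are powers of
   [eps]; [nu] raises each of them to the power [k]. *)
rewrite !res ?groupX//; have [r ->] := char_sum_irr (cfRes_char <[g]> Nchi).
rewrite !sum_cfunE rmorph_sum; apply: eq_bigr => i _.
have Lchi : 'chi_i \is a linear_char by rewrite irr_cyclic_lin ?cycle_cyclic.
rewrite lin_charX//.
have [b bE] := QnG _ _ _ (irr_char i) g (dvdnn _).
have /(prim_rootP pr_eps)[m bm] : b ^+ n = 1.
  apply/eqP; rewrite -(fmorph_eq1 QnC) rmorphXn /= bE -lin_charX//.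
  by rewrite expg_order lin_char1.
by rewrite -bE -nuCE bm !rmorphXn /= nu_eps rmorphXn /= exprAC.
Qed.

Section SymmetricGroupCharacters.

Variable d : nat.

(** For [k] prime to the order of [s], the power [s ^+ k] has the same orbits as [s], hence is
    conjugate to it. *)
Lemma chi_Sn_int (i : Iirr [set: 'S_d]) s : 'chi_i s \is a Num.int.
Proof.
apply: char_rational_class_int; rewrite ?irr_char ?inE// => k cop.
apply/imsetP; case: (pickP [pred x : 'I_d | true]) => [x _|d0]; last first.
  by exists 1%g; rewrite ?inE//; apply/permP => x; have := d0 x.
have [c [sc _ _]] := @perm_conj_of_porbit _ s (s ^+ k)%g x (fun y => porbitX y cop).
by exists c; rewrite ?inE// conjgE sc mulKg.
Qed.

Lemma irr_valE la (s : 'S_d) : (irr_val la s)%:~R = 'chi_(irr_part d la) s.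
Proof. by rewrite floorK// chi_Sn_int. Qed.

Lemma irr_val_cycle_type la (s t : 'S_d) :
  cycle_type s = cycle_type t -> irr_val la s = irr_val la t.
Proof.
move=> st; have [|c sc] := @perm_conj_of_cards _ s t.
  apply: (@perm_trans _ (cycle_type s)); first by rewrite perm_sym perm_sort.
  by rewrite st perm_sort.
have -> : t = (s ^ c)%g by rewrite conjgE sc mulKg.
by rewrite /irr_val cfunJ ?inE.
Qed.

Lemma sum_irr_val_sqr la : \sum_(s : 'S_d) irr_val la (s * s)%g = d`!%:Z.
Proof.
apply/eqP; rewrite -(eqr_int algC) rmorph_sum /=; apply/eqP.
under eq_bigr do rewrite irr_valE.
have SymT : [set: 'S_d] = Sym [set: 'I_d].
  by apply/setP => s; rewrite !inE; apply/esym/subsetP => x; rewrite inE.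
have /(canRL (mulVKf (neq0CG _))) :=
  @fs_indicator_Sym _ [set: 'I_d] [set: 'S_d]%G SymT (irr_part d la).
have -> : #|[set: 'S_d]| = d`! by rewrite SymT card_Sym cardsT card_ord.
rewrite mulr1 pmulrn => <-.
by apply: eq_bigl => s; rewrite inE.
Qed.

Lemma cycle_type_part (s : 'S_d) : partitions d (cycle_type s).
Proof.
split.
  apply/andP; split; first by apply: sort_sorted => a b; exact: leq_total.
  rewrite mem_sort; apply/mapP => -[X]; rewrite mem_enum => /imsetP[x _ ->] /esym/eqP.
  by rewrite (negPf (card_porbit_neq0 _ _)).
have -> : sumn (cycle_type s) = (\sum_(X in porbits s) #|X|)%N.
  rewrite /cycle_type -big_enum -(big_map (fun X : {set 'I_d} => #|X|) xpredT id).
  by rewrite sumnE; apply: perm_big; rewrite perm_sort.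
rewrite -[RHS]card_ord -[RHS]cardsT -sum1_card.
rewrite (partition_big (porbit s) (mem (porbits s))) /= => [|x _]; last exact: imset_f.
apply: eq_bigr => X /imsetP[x _ ->]; rewrite -sum1_card; apply: eq_bigl => y.
by rewrite inE eq_porbit_mem.
Qed.

End SymmetricGroupCharacters.

(** * Derivations and substitutions of polynomials *)

Section Polynomials.

Variables (K : numFieldType) (I : choiceType).
Local Notation cm := {cmonom I}.
Local Notation ppoly := {malg K[cm]}.
Implicit Types (f g q : ppoly) (k : cm) (u v w : I).
Local Notation "1" := mone : monom_scope.
Local Notation "x * y" := (mmul x y) : monom_scope.
Local Bind Scope monom_scope with cmonom.
Local Delimit Scope monom_scope with M.

Definition mvar v : ppoly := << ucm v >>.

(** At [K = R[i]] and [u = (j, m)] this is [pderiv j m] by conversion. *)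
Definition mderiv u f : ppoly :=
  \sum_(k <- msupp f) << (f@_k *+ k u) *g divcm k (ucm u) >>.

Lemma cm_factor k v : (0 < k v)%N -> k = (ucm v * divcm k (ucm v))%M.
Proof.
move=> kv; apply/eqP/cmP => w; rewrite cmM divcmE ucmE.
by case: (v =P w) => [<-|_] /=; rewrite ?subnKC// subn0.
Qed.

Lemma divcmK k v : divcm (k * ucm v)%M (ucm v) = k.
Proof. by apply/eqP/cmP => w; rewrite divcmE cmM addnK. Qed.

Lemma malg_mulUU (a b : K) k l : << a *g k >> * << b *g l >> = << a * b *g k * l >> :> ppoly.
Proof. by rewrite malgM_def fgmulUU. Qed.

Lemma malgU_prod k : exists s : seq I, << k >> = \prod_(v <- s) mvar v.
Proof.
have [n] := ubnP (mdeg k); elim: n k => // n IH k lt_k.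
have [->|/eqP k1] := eqVneq k 1%M; first by exists [::]; rewrite big_nil.
have [v kv] : exists v, (0 < k v)%N.
  apply: contrapT => k0; apply: k1; apply/eqP/cmP => v; rewrite cm1.
  by apply/eqP; apply: contrapT => /negP; rewrite -lt0n => kv; apply: k0; exists v.
have kE := cm_factor kv.
have [|s sE] := IH (divcm k (ucm v)).
  by move: lt_k; rewrite {1}kE mdegM mdegU add1n ltnS.
by exists (v :: s); rewrite big_cons -sE malg_mulUU mulr1 -kE.
Qed.

Lemma malgUE (a : K) k : << a *g k >> = a *: << k >> :> ppoly.
Proof. by rewrite -mul_malgC malg_mulUU mulr1 mul1m. Qed.

(** With this principle, the product rule and the multiplicativity of substitutions are needed only
    when one factor is a variable. *)
Lemma ppoly_ind (P : ppoly -> Prop) :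
    P 1 -> (forall f g, P f -> P g -> P (f + g)) -> (forall c f, P f -> P (c *: f)) ->
    (forall v f, P f -> P (mvar v * f)) ->
  forall f, P f.
Proof.
move=> P1 PD PZ PM f; rewrite (monalgE f).
elim: (enum_fset (msupp f)) => [|k s IHs].
  by rewrite big_nil -(scale0r 1); apply: PZ.
rewrite big_cons; apply: PD; last exact: IHs.
rewrite malgUE; apply: PZ; have [t ->] := malgU_prod k.
elim: t => [|v t IHt]; first by rewrite big_nil.
by rewrite big_cons; apply: PM.
Qed.

(** Reading derivatives coefficientwise gives linearity and the commutation of derivations by
    comparing coefficients. *)
Lemma mcoeff_mderiv u f k : (mderiv u f)@_k = f@_(k * ucm u)%M *+ (k u).+1.
Proof.
set k' := (k * ucm u)%M.
have k'u : k' u = (k u).+1 by rewrite cmM ucmE eqxx addn1.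
have off l : l != k' -> (f@_l *+ l u) *+ (divcm l (ucm u) == k) = 0.
  move=> lk; have [l0|l0] := posnP (l u); first by rewrite l0 mulr0n mul0rn.
  case: eqP => [lkE|]; rewrite ?mulr0n//; case/eqP: lk.
  by rewrite (cm_factor l0) lkE mulmC.
rewrite /mderiv raddf_sum /=; under eq_bigr do rewrite mcoeffU.
have [fk'|fk'] := boolP (k' \in msupp f); last first.
  rewrite (mcoeff_outdom fk') mul0rn big1_seq// => l /andP[_ lf]; apply: off.
  by apply: contraNneq fk' => <-.
have k'k : divcm k' (ucm u) = k by exact: divcmK.
rewrite (bigD1_seq k' fk' (fset_uniq _)) big1 => [|l]; last exact: off.
by rewrite /= addr0 [X in nat_of_bool X](introT eqP k'k) mulr1n k'u.
Qed.

Lemma mderiv_is_linear u : linear (mderiv u).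
Proof.
move=> c f g; apply/malgP => k.
rewrite [LHS]mcoeff_mderiv [in LHS]mcoeffD [X in (X + _) *+ _]mcoeffZ.
rewrite [RHS]mcoeffD [X in _ = X + _]mcoeffZ.
rewrite [X in _ = _ * X + _]mcoeff_mderiv [X in _ = _ + X]mcoeff_mderiv.
by rewrite mulrnDl mulrnAr.
Qed.

HB.instance Definition _ u :=
  GRing.isLinear.Build K ppoly ppoly *:%R (mderiv u) (mderiv_is_linear u).

Lemma mderivC u v f : mderiv u (mderiv v f) = mderiv v (mderiv u f).
Proof.
apply/malgP => k; rewrite [LHS]mcoeff_mderiv [X in X *+ _ = _]mcoeff_mderiv.
rewrite [RHS]mcoeff_mderiv [X in _ = X *+ _]mcoeff_mderiv !cmM !ucmE -!mulrnA.
have -> : (k * ucm u * ucm v = k * ucm v * ucm u)%M.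
  by apply/eqP/cmP => w; rewrite !cmM addnAC.
have [->//|uv] := eqVneq u v.
by rewrite /= !addn0 mulnC.
Qed.

Lemma mderiv1 u : mderiv u 1 = 0.
Proof.
apply/malgP => k; rewrite [LHS]mcoeff_mderiv [RHS]mcoeff0 mcoeff1.
case: eqP => [/(congr1 (fun l : cm => l u))|]; last by rewrite mul0rn.
by rewrite cmM cm1 ucmE eqxx addn1.
Qed.

Lemma mderivU u (a : K) k : mderiv u << a *g k >> = << a *+ k u *g divcm k (ucm u) >>.
Proof.
apply/malgP => l; rewrite [LHS]mcoeff_mderiv [in LHS]mcoeffU [RHS]mcoeffU.
have [k0|k0] := posnP (k u).
  rewrite k0 mulr0n mul0rn; case: eqP => [kE|_]; last by rewrite !mul0rn.
  by move: k0; rewrite kE cmM ucmE eqxx addn1.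
have -> : (k == l * ucm u)%M = (divcm k (ucm u) == l).
  apply/eqP/eqP => [->|<-]; first by rewrite divcmK.
  by rewrite mulmC -cm_factor.
case: eqP => [<-|_]; last by rewrite !mul0rn.
by rewrite divcmE ucmE eqxx subn1 prednK// -!mulrnA mul1n muln1.
Qed.

Lemma mderivM u v f :
  mderiv u (mvar v * f) = (u == v)%:R *: f + mvar v * mderiv u f.
Proof.
rewrite (monalgE f); elim: (enum_fset (msupp f)) => [|k s IHs].
  by rewrite big_nil mulr0 raddf0 scaler0 mulr0 addr0.
rewrite big_cons mulrDr !raddfD /= mulrDr [X in _ + X = _]IHs addrACA.
apply: (congr1 (fun z => z + _)).
move: (f@_k) => a {f s IHs}.
have mulU l (b : K) : mvar v * << b *g l >> = << b *g ucm v * l >>.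
  by rewrite /mvar malg_mulUU mul1r.
have dU : mvar v * mderiv u << a *g k >> =
    << a *+ k u *g ucm v * divcm k (ucm u) >> by rewrite mderivU mulU.
rewrite [X in _ = _ + X]dU (mulU k) mderivU cmM ucmE.
have [->|uv] := altP (u =P v); last first.
  have -> : (ucm v * divcm k (ucm u))%M = divcm (ucm v * k)%M (ucm u).
    apply/eqP/cmP => w; rewrite !(cmM, divcmE, ucmE).
    by case: (v =P w) => [<-|_]; rewrite ?add0n// (negPf uv) !subn0.
  have E (x y : ppoly) : (nat_of_bool false)%:R *: x + y = y.
    by rewrite scale0r add0r.
  rewrite [RHS]E (eq_sym v) (negPf uv) add0n; exact: erefl.
have E (x y : ppoly) : (nat_of_bool true)%:R *: x + y = x + y by rewrite scale1r.
rewrite [RHS]E eqxx add1n [X in << _ *g divcm X _ >>]mulmC divcmK mulrSr.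
have [k0|k0] := posnP (k v).
  rewrite k0 mulr0n add0r monalgU0 addr0; exact: erefl.
rewrite -(cm_factor k0) addrC; exact: monalgUD.
Qed.

Variable phi : I -> ppoly.

Definition mpsubst f : ppoly :=
  mmap malgC (fun k => \prod_(v <- finsupp k) phi v ^+ k v) f.

Lemma cm_prodM v k :
  \prod_(w <- finsupp (ucm v * k)%M) phi w ^+ (ucm v * k)%M w =
  phi v * \prod_(w <- finsupp k) phi w ^+ k w.
Proof.
have wide (d : {fset I}) (l : cm) : (finsupp l `<=` d)%fset ->
    \prod_(w <- finsupp l) phi w ^+ l w = \prod_(w <- d) phi w ^+ l w.
  move=> ld; rewrite (big_fset_incl _ ld)// => w _; rewrite -cmE_eq0 => /eqP->.
  by rewrite expr0.
have vk : v \in finsupp (ucm v * k)%M by rewrite -cmE_neq0 cmM cmUU.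
rewrite [X in _ = _ * X](wide (finsupp (ucm v * k)%M)); last first.
  by rewrite mdomD; apply: fsubsetUr.
rewrite (bigD1_seq v vk (fset_uniq _)) [X in _ = _ * X](bigD1_seq v vk (fset_uniq _)) /=.
rewrite cmM cmUU exprD expr1 mulrA; congr (_ * _).
apply: eq_bigr => w; rewrite cmM ucmE eq_sym => /negPf->; by rewrite add0n.
Qed.

Lemma mpsubst_is_linear : linear mpsubst.
Proof.
move=> c f g; rewrite /mpsubst raddfD /=; apply: (congr1 (fun z => z + _)).
rewrite [LHS](mmapEw (msuppZ_le c f)) [X in _ = _ *: X]mmapE scaler_sumr.
apply: eq_bigr => k _; rewrite [in LHS]mcoeffZ -[RHS]mul_malgC [RHS]mulrA.
apply: (congr1 (fun z => z * _)); exact: mpolyCM.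
Qed.

HB.instance Definition _ :=
  GRing.isLinear.Build K ppoly ppoly *:%R mpsubst mpsubst_is_linear.

Lemma mpsubst1 : mpsubst 1 = 1.
Proof. by rewrite /mpsubst -{1}mpolyC1E [LHS]mmapU mpolyC1E mul1r mdom1 big_seq_fset0. Qed.

Lemma mpsubstM v f : mpsubst (mvar v * f) = phi v * mpsubst f.
Proof.
rewrite (monalgE f); elim: (enum_fset (msupp f)) => [|k s IHs].
  by rewrite big_nil mulr0 raddf0 mulr0.
rewrite big_cons mulrDr !raddfD /= [X in _ + X = _]IHs mulrDr.
apply: (congr1 (fun z => z + _)); move: (f@_k) => a {f s IHs}.
have -> : mvar v * << a *g k >> = << a *g ucm v * k >>.
  by rewrite /mvar malg_mulUU mul1r.
rewrite /mpsubst [LHS]mmapU [X in _ * X = _]cm_prodM [X in _ = _ * X]mmapU.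
exact: mulrCA.
Qed.

End Polynomials.

(** * The exponential of the operator L *)

Section HeatOperator.

Variables (K : numFieldType) (A : comAlgType K) (j : nat) (x : nat * nat -> A).
Variables (D : nat -> {linear A -> A}) (S : {linear A -> A}).
(** The polynomial ring enters this section only through these rules for the variables [x], the
    derivations [D] and the substitution [S]. *)
Hypothesis A_ind : forall P : A -> Prop,
    P 1 -> (forall f g, P f -> P g -> P (f + g)) -> (forall c f, P f -> P (c *: f)) ->
    (forall v f, P f -> P (x v * f)) ->
  forall f, P f.
Hypothesis D_comm : forall m l f, D m (D l f) = D l (D m f).
Hypothesis D1 : forall m, D m 1 = 0.
Hypothesis DM : forall m v f, D m (x v * f) = ((j, m) == v)%:R *: f + x v * D m f.
Hypothesis S1 : S 1 = 1.
Hypothesis SM : forall v f, S (x v * f) = (if v.1 == j then 0 else x v) * S f.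

Implicit Types (f g q : A).

(* [L_op j], [Linf j] and [exp_op] are instances of [heat_op], [toda_op] and  *)
(* [exp_series] up to conversion, with [D m] the derivation of [p^(j)_m].     *)
Definition heat_op f : A :=
  \sum_(m \in [set m : nat | (0 < m)%N]%classic)
    (((m%:R / 2) : K) *: D m (D m f) + D (2 * m).-1 f).

Definition toda_op f : A :=
  \sum_(m \in [set m : nat | (1 <= m)%N]%classic)
    ((m%:R : K) *: D m (D m f)) +
  (2 : K) *: \sum_(m \in [set m : nat | (1 <= m)%N && odd m]%classic) D m f.

Definition exp_series (L : A -> A) f : A :=
  \sum_(k \in [set: nat]%classic) ((k`!%:R^-1 : K) *: iter k L f).

(** Both infinite sums are merged into one finite sum, with the derivatives in [p_(2m-1)] reindexed
    by odd [m]; the index 0 contributes nothing. *)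
Definition heat_trunc B f : A :=
  \sum_(0 <= m < B) ((m%:R / 2 : K) *: D m (D m f) + ((odd m)%:R : K) *: D m f).

Lemma D_bounded f : exists B, forall m, (B <= m)%N -> D m f = 0.
Proof.
elim/A_ind: f => [|f g [B fB] [B' gB]|c f [B fB]|[i l] f [B fB]].
- by exists 0%N => m _; rewrite D1.
- exists (maxn B B') => m; rewrite geq_max => /andP[Bm B'm].
  by rewrite raddfD /= fB// gB// addr0.
- by exists B => m Bm; rewrite linearZ /= fB// scaler0.
- exists (maxn B l.+1) => m; rewrite geq_max => /andP[Bm lm].
  by rewrite DM fB// mulr0 addr0 xpair_eqE (gtn_eqF lm) andbF scale0r.
Qed.

Lemma fsum_nat_bounded (P : pred nat) (F : nat -> A) B :
  (forall m, (B <= m)%N -> F m = 0) ->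
  \sum_(m \in [set m | P m]%classic) F m = \sum_(0 <= m < B | P m) F m.
Proof.
move=> F0; rewrite (fsbigE (filter P (index_iota 0 B))).
- rewrite big_filter_cond; apply: eq_bigl => m.
  by rewrite andb_idr// => Pm; apply/mem_set.
- by rewrite filter_uniq// iota_uniq.
- by move=> m /=; rewrite mem_filter => /andP[].
- move=> m /= Pm; rewrite mem_filter Pm mem_index_iota /= -leqNgt; exact: F0.
Qed.

Lemma sum_odd (F : nat -> A) B :
  \sum_(1 <= m < B.+1) F (2 * m).-1 = \sum_(0 <= m < B.*2) ((odd m)%:R : K) *: F m.
Proof.
elim: B => [|B IH]; first by rewrite !big_geq.
rewrite big_nat_recr//= IH doubleS 2?big_nat_recr//= odd_double scale0r addr0.
by rewrite scale1r -mul2n; congr (_ + F _); lia.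
Qed.

Lemma sum_nat_trunc (F : nat -> A) B B' : (forall m, (B <= m)%N -> F m = 0) ->
  (B <= B')%N -> \sum_(0 <= m < B') F m = \sum_(0 <= m < B) F m.
Proof.
move=> F0 leB; rewrite (big_cat_nat (n := B))//= [X in _ + X]big_nat_cond.
rewrite [X in _ + X]big1 ?addr0//.
by move=> m /andP[/andP[Bm _] _]; apply: F0.
Qed.

Lemma heat_opE f B : (forall m, (B <= m)%N -> D m f = 0) -> heat_op f = heat_trunc B f.
Proof.
move=> f0; rewrite /heat_op (@fsum_nat_bounded _ _ B.+1) => [|m Bm]; last first.
  by rewrite !f0 ?raddf0 ?scaler0 ?addr0//; lia.
rewrite /heat_trunc !big_split /=; congr (_ + _).
  rewrite [LHS]big_mkcond -(@sum_nat_trunc _ B B.+1) => [|m Bm|//]; last first.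
    by rewrite f0// raddf0 scaler0.
  by apply: eq_bigr => -[|m] _ //=; rewrite mul0r scale0r.
(* The range is extended by vanishing terms up to [2B], where the odd indices are the [2m - 1] with
   [1 <= m <= B]. *)
rewrite -(@sum_nat_trunc _ B B.*2) => [|m Bm|]; last 2 first.
- by rewrite f0// scaler0.
- by lia.
rewrite -sum_odd big_mkcond big_ltn//= add0r.
by rewrite big_nat_cond [RHS]big_nat_cond; apply: eq_bigr => m /andP[/andP[-> _] _].
Qed.

Lemma half_toda_op f : (2^-1 : K) *: toda_op f = heat_op f.
Proof.
have [B f0] := D_bounded f; rewrite (heat_opE f0) /toda_op scalerDr scalerA.
rewrite mulVf ?pnatr_eq0// scale1r !(@fsum_nat_bounded _ _ B) => [|m Bm|m Bm];
  rewrite ?f0// ?raddf0 ?scaler0//.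
rewrite /heat_trunc big_split scaler_sumr /=; congr (_ + _); rewrite big_mkcond.
  apply: eq_bigr => -[|m] _ /=; first by rewrite mul0r scale0r.
  by rewrite scalerA mulrC.
apply: eq_bigr => -[|m] _ /=; first by rewrite scale0r.
by case: ifP; rewrite ?scale1r ?scale0r.
Qed.

Lemma D_bounded_all (s : seq A) :
  exists B, forall m f, (B <= m)%N -> f \in s -> D m f = 0.
Proof.
elim: s => [|f s [B sB]]; first by exists 0%N.
have [B' fB] := D_bounded f; exists (maxn B B') => m g; rewrite geq_max.
move=> /andP[Bm B'm]; rewrite inE => /orP[/eqP->|gs]; first exact: fB.
exact: sB.
Qed.

Lemma heat_op_is_linear : linear heat_op.
Proof.
move=> c f g; have [B fB] := D_bounded_all [:: c *: f + g; f; g].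
have B0 h : h \in [:: c *: f + g; f; g] -> heat_op h = heat_trunc B h.
  by move=> hs; apply: heat_opE => m Bm; apply: fB.
rewrite !B0 ?inE ?eqxx ?orbT// /heat_trunc scaler_sumr -big_split /=.
apply: eq_bigr => m _; rewrite !linearP /= addrACA; congr (_ + _ + _).
by rewrite !scalerA mulrC.
Qed.

HB.instance Definition _ := GRing.isLinear.Build K A A *:%R heat_op heat_op_is_linear.

Lemma heat_op_comm l f : heat_op (D l f) = D l (heat_op f).
Proof.
have [B fB] := D_bounded f.
rewrite (heat_opE fB) (@heat_opE _ B) => [|m Bm]; last by rewrite D_comm fB// raddf0.
rewrite /heat_trunc raddf_sum; apply: eq_bigr => m _ /=.
by rewrite linearD !linearZ /= ![D m (D l _)]D_comm.
Qed.

(** This is the commutator of [heat_op] with multiplication by [x (j, l)]. *)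
Definition heat_comm l f : A := (l%:R : K) *: D l f + ((odd l)%:R : K) *: f.

Lemma heat_op_mul v f :
  heat_op (x v * f) = x v * heat_op f + (v.1 == j)%:R *: heat_comm v.2 f.
Proof.
case: v => i l /=; set v := (i, l).
have [B fB] := D_bounded_all [:: x v * f; f].
pose B' := maxn B l.+1.
have B0 h : h \in [:: x v * f; f] -> heat_op h = heat_trunc B' h.
  move=> hs; apply: heat_opE => m Bm; apply: fB hs.
  by rewrite (leq_trans (leq_maxl _ _) Bm).
have termE m : (m%:R / 2 : K) *: D m (D m (x v * f)) + ((odd m)%:R : K) *: D m (x v * f) =
    x v * ((m%:R / 2 : K) *: D m (D m f) + ((odd m)%:R : K) *: D m f)
    + ((j, m) == v)%:R *: heat_comm m f.
  rewrite !DM raddfD /= linearZ /= DM /heat_comm.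
  case: eqP => _; last by rewrite !scale0r !add0r addr0 mulrDr -!scalerAr.
  rewrite !scale1r mulrDr -!scalerAr [in m%:R *: _](splitr m%:R) scalerDl !scalerDr.
  move: (_ *: D m f) (_ *: f) (_ *: (x v * _)) (_ *: (x v * _)) => a b c e.
  ring.
rewrite !B0 ?inE ?eqxx ?orbT// /heat_trunc.
under [LHS]eq_bigr do rewrite termE.
rewrite big_split /= -mulr_sumr; congr (_ + _).
rewrite (bigD1_seq l) ?mem_index_iota ?iota_uniq ?leq_maxr//=.
rewrite big1 ?addr0 => [|m ml]; first by rewrite /v xpair_eqE eqxx andbT eq_sym.
by rewrite /v xpair_eqE (negPf ml) andbF scale0r.
Qed.

Lemma iter_heat_op_is_linear k : linear (iter k heat_op).
Proof. by elim: k => // k IH c f g; rewrite !iterS IH linearP. Qed.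

HB.instance Definition _ k :=
  GRing.isLinear.Build K A A *:%R (iter k heat_op) (iter_heat_op_is_linear k).

Lemma iter_heat_op_comm k l f :
  iter k heat_op (heat_comm l f) = heat_comm l (iter k heat_op f).
Proof.
elim: k => // k IH; rewrite !iterS IH /heat_comm linearD !linearZ /=.
by rewrite heat_op_comm.
Qed.

(** The commutator of [heat_op] with a variable itself commutes with [heat_op], so moving the
    variable past the [k]-th power costs [k] times that commutator. At [k = 0] the coefficient kills
    the truncated predecessor. *)
Lemma iter_heat_op_mul k v f :
  iter k heat_op (x v * f) = x v * iter k heat_op f +
    ((v.1 == j) * k)%:R *: iter k.-1 heat_op (heat_comm v.2 f).
Proof.
elim: k => [|k IH]; first by rewrite muln0 scale0r addr0.
rewrite iterS IH linearD linearZ /= heat_op_mul -iterS -addrA; congr (_ + _).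
rewrite -iter_heat_op_comm mulnS natrD scalerDl; congr (_ + _).
by case: k {IH} => [|k]; rewrite ?muln0 ?scale0r.
Qed.

(** Multiplying by a variable raises the order of nilpotency by at most 1. Local nilpotency makes
    the exponential a finite sum. *)
Lemma heat_op_nilpotent f : exists n, forall k, (n <= k)%N -> iter k heat_op f = 0.
Proof.
elim/A_ind: f => [|f g [n fn] [n' gn]|c f [n fn]|v f [n fn]].
- exists 1%N => -[//|k] _; rewrite iterSr (@heat_opE _ 0) ?/heat_trunc ?big_geq//.
  exact: raddf0.
- exists (maxn n n') => k; rewrite geq_max => /andP[nk nk'].
  by rewrite raddfD /= fn// gn// addr0.
- by exists n => k nk; rewrite linearZ /= fn// scaler0.
- exists n.+1 => -[//|k] nk; rewrite iter_heat_op_mul fn ?(ltnW nk)// mulr0 add0r.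
  rewrite iter_heat_op_comm fn//.
  by rewrite /heat_comm raddf0 !scaler0 addr0 scaler0.
Qed.

Lemma exp_seriesE f n : (forall k, (n <= k)%N -> iter k heat_op f = 0) ->
  exp_series heat_op f = \sum_(0 <= k < n) ((k`!%:R^-1 : K) *: iter k heat_op f).
Proof.
move=> fn; rewrite /exp_series.
rewrite (_ : [set: nat]%classic = [set m : nat | xpredT m]%classic).
  by rewrite (@fsum_nat_bounded _ _ n)// => k nk; rewrite fn// scaler0.
by apply/seteqP; split.
Qed.

Definition heat_eval f : A := S (exp_series heat_op f).

Lemma exp_heat_bound2 f g : exists n, exp_series heat_op f =
    \sum_(0 <= k < n) ((k`!%:R^-1 : K) *: iter k heat_op f) /\
  forall k, (n <= k)%N -> iter k heat_op f = 0 /\ iter k heat_op g = 0.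
Proof.
have [n fn] := heat_op_nilpotent f; have [n' gn] := heat_op_nilpotent g.
have bound k : (maxn n n' <= k)%N -> iter k heat_op f = 0 /\ iter k heat_op g = 0.
  by rewrite geq_max => /andP[nk nk']; rewrite fn// gn.
by exists (maxn n n'); split=> //; apply: exp_seriesE => k /bound[].
Qed.

Lemma heat_eval_is_linear : linear heat_eval.
Proof.
move=> c f g; rewrite /heat_eval; have [n [-> fgn]] := exp_heat_bound2 f g.
rewrite (@exp_seriesE g n) => [|k /fgn[]//].
rewrite (@exp_seriesE (c *: f + g) n) => [|k /fgn[f0 g0]]; last first.
  by rewrite linearP /= f0 g0 scaler0 addr0.
rewrite -linearP; congr (S _); rewrite scaler_sumr -big_split; apply: eq_bigr => k _ /=.
by rewrite linearP scalerDr !scalerA mulrC.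
Qed.

HB.instance Definition _ :=
  GRing.isLinear.Build K A A *:%R heat_eval heat_eval_is_linear.

Lemma heat_eval1 : heat_eval 1 = 1.
Proof.
rewrite /heat_eval (@exp_seriesE _ 1) => [|[//|k] _]; last first.
  rewrite iterSr (@heat_opE _ 0) ?/heat_trunc ?big_geq//; exact: raddf0.
by rewrite big_nat1 /= invr1 scale1r.
Qed.

(** As [c = [L, x]] commutes with [L], one has [e^L x = x e^L + e^L c]; then [S] is applied. *)
Lemma heat_eval_mul v f : heat_eval (x v * f) =
  (if v.1 == j then 0 else x v) * heat_eval f +
  (v.1 == j)%:R *: heat_eval (heat_comm v.2 f).
Proof.
rewrite /heat_eval -SM -linearZ -linearD /=; congr (S _).
have [n [fE fn]] := exp_heat_bound2 f (heat_comm v.2 f).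
rewrite fE (@exp_seriesE (heat_comm _ _) n) => [|k /fn[]//].
rewrite (@exp_seriesE (x v * f) n.+1) => [|[//|k] nk]; last first.
  have [_ cf] := fn _ (nk : (n <= k)%N).
  by rewrite iter_heat_op_mul (fn _ (ltnW nk)).1 mulr0 add0r cf scaler0.
under eq_bigr do rewrite iter_heat_op_mul scalerDr.
rewrite big_split /=; congr (_ + _).
  rewrite big_nat_recr//= (fn n (leqnn _)).1 mulr0 scaler0 addr0 mulr_sumr.
  by apply: eq_bigr => k _; rewrite scalerAr.
rewrite big_nat_recl//= muln0 scale0r scaler0 add0r scaler_sumr.
apply: eq_bigr => k _; rewrite !scalerA; congr (_ *: _).
by rewrite factS !natrM invfM mulrC -mulrA mulVKf ?pnatr_eq0.
Qed.

Lemma heat_eval_free v f : v.1 != j -> heat_eval (x v * f) = x v * heat_eval f.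
Proof. by move=> /negPf vj; rewrite heat_eval_mul vj scale0r addr0. Qed.

Definition power_prod (De : seq nat) : A := \prod_(l <- De) x (j, l).

Lemma D_power_prod m De :
  D m (power_prod De) = (count_mem m De)%:R *: power_prod (rem m De).
Proof.
elim: De => [|l De IH] /=; first by rewrite /power_prod !big_nil D1 scale0r.
rewrite {1}/power_prod big_cons DM IH xpair_eqE eqxx /= eq_sym natrD scalerDl.
have [->|lm] := eqVneq l m; last first.
  by rewrite !scale0r !add0r {2}/power_prod big_cons scalerAr.
congr (_ + _); have [mDe|mDe] := boolP (m \in De); last first.
  by rewrite (count_memPn mDe) !scale0r mulr0.
rewrite -scalerAr; congr (_ *: _).
by rewrite /power_prod (perm_big _ (perm_to_rem mDe)) big_cons.
Qed.

(** Setting the variable to 0 leaves only the commutator [m d/dp_m + [m odd]]. The result is the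
    recursion [W_cons] of the square root count. *)
Lemma heat_eval_power_cons m De : heat_eval (power_prod (m :: De)) =
  (odd m)%:R * heat_eval (power_prod De) +
  (m * count_mem m De)%:R * heat_eval (power_prod (rem m De)).
Proof.
rewrite {1}/power_prod big_cons heat_eval_mul /= eqxx mul0r add0r scale1r.
rewrite /heat_comm linearD !linearZ /= D_power_prod linearZ /= addrC scalerA -natrM.
by rewrite !scaler_nat !mulr_natl.
Qed.

End HeatOperator.

(** * Linearity over the other families of variables *)

Section CommutesWithMul.

Variables (K : pzRingType) (A : comAlgType K) (W : {linear A -> A}).

Definition commutes_with_mul (c : A) := forall f, W (c * f) = c * W f.

Lemma commutes_with_mul1 : commutes_with_mul 1.
Proof. by move=> f; rewrite !mul1r. Qed.

Lemma commutes_with_mulM c c' :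
  commutes_with_mul c -> commutes_with_mul c' -> commutes_with_mul (c * c').
Proof. by move=> Wc Wc' f; rewrite -!mulrA Wc Wc'. Qed.

Lemma commutes_with_mulZ (a : K) c :
  commutes_with_mul c -> commutes_with_mul (a *: c).
Proof. by move=> Wc f; rewrite -!scalerAl linearZ /= Wc. Qed.

Lemma commutes_with_mul_fsum (I : choiceType) (P : set I) (c : I -> A) :
  (forall i, commutes_with_mul (c i)) -> commutes_with_mul (\sum_(i \in P) c i).
Proof.
move=> Wc f; rewrite !mulr_suml raddf_sum; apply: eq_bigr => i _; exact: Wc.
Qed.

Lemma linear_fsum (I : choiceType) (P : set I) (c : I -> A) : finite_set P ->
  W (\sum_(i \in P) c i) = \sum_(i \in P) W (c i).
Proof. by move=> finP; rewrite !fsbig_finite// raddf_sum. Qed.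

Lemma linear_comb (I : finType) (a : K) (c : I -> K) (X : I -> A) :
  W (a *: \sum_i c i *: X i) = a *: \sum_i c i *: W (X i).
Proof.
by rewrite linearZ linear_sum; congr (_ *: _); apply: eq_bigr => i _; rewrite linearZ.
Qed.

End CommutesWithMul.

(** * The operator [L] on polynomials in the power sums *)

Section PowerSumPolynomials.

Variable R : realType.
Local Notation C := R[i].
Local Notation A := {malg C[{cmonom (nat * nat)%type}]}.

Let K : numFieldType := C.
Let D (j m : nat) : {linear A -> A} := @mderiv K (nat * nat)%type (j, m).
(* [(v.1, v.2)] in place of [v] makes [at_p0] convertible to [mpsubst].       *)
Let phi j (v : nat * nat) : A := if v.1 == j then 0 else @mvar K _ (v.1, v.2).
Let S j : {linear A -> A} := @mpsubst K _ (phi j).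
Let x : nat * nat -> A := @mvar K (nat * nat)%type.

Definition exp_L_eval j (f : A) : A := at_p0 j (exp_op (L_op j) f).

Let SM j v f : S j (x v * f) = (if v.1 == j then 0 else x v) * S j f.
Proof.
rewrite [LHS]mpsubstM /phi -surjective_pairing; exact: erefl.
Qed.

Let x_ind : forall P : A -> Prop,
    P 1 -> (forall f g, P f -> P g -> P (f + g)) -> (forall c f, P f -> P (c *: f)) ->
    (forall v f, P f -> P (x v * f)) -> forall f, P f := @ppoly_ind K _.
Let D_comm j m l f : D j m (D j l f) = D j l (D j m f) := @mderivC K _ _ _ f.
Let D1 j m : D j m 1 = 0 := @mderiv1 K _ _.
Let DM j m v f : D j m (x v * f) = ((j, m) == v)%:R *: f + x v * D j m f :=
  @mderivM K _ _ _ f.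
Let S1 j : S j 1 = 1 := @mpsubst1 K _ _.

Lemma exp_L_eval_is_linear j : linear (exp_L_eval j).
Proof.
exact: (@heat_eval_is_linear K _ j x (D j) (S j)
  x_ind (@D_comm j) (D1 j) (@DM j)).
Qed.

HB.instance Definition _ j :=
  GRing.isLinear.Build C A A *:%R (exp_L_eval j) (exp_L_eval_is_linear j).

Lemma exp_L_eval1 j : exp_L_eval j 1 = 1.
Proof. exact: (@heat_eval1 K _ j x (D j) (S j) x_ind (D1 j) (@DM j) (S1 j)). Qed.

Lemma exp_L_eval_pvarM i j m f : i != j ->
  exp_L_eval j (pvar R i m * f) = pvar R i m * exp_L_eval j f.
Proof.
move=> ij; exact: (@heat_eval_free K _ j x (D j) (S j)
  x_ind (@D_comm j) (D1 j) (@DM j) (@SM j) (i, m) f ij).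
Qed.

Lemma exp_L_eval_psum_cons j m De :
  exp_L_eval j (psum_part (pvar R j) (m :: De)) =
    (odd m)%:R * exp_L_eval j (psum_part (pvar R j) De) +
    (m * count_mem m De)%:R * exp_L_eval j (psum_part (pvar R j) (rem m De)).
Proof.
exact: (@heat_eval_power_cons K _ j x (D j) (S j)
  x_ind (@D_comm j) (D1 j) (@DM j) (@SM j) m De).
Qed.

Lemma half_Linf j : (fun f => (2^-1 : C) *: Linf j f) = L_op j.
Proof.
apply/funext => f.
exact: (@half_toda_op K _ j x (D j) x_ind (D1 j) (@DM j) f).
Qed.

Lemma exp_L_eval_schur_semilinear i j la :
  i != j -> commutes_with_mul (exp_L_eval j) (schur la (pvar R i)).
Proof.
move=> ij; apply: commutes_with_mulZ.
apply: commutes_with_mul_fsum => De.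
apply: commutes_with_mulZ; rewrite /psum_part.
elim: De => [|m De IH]; first by rewrite big_nil; apply: commutes_with_mul1.
rewrite big_cons; apply: commutes_with_mulM IH => f; exact: exp_L_eval_pvarM.
Qed.

Lemma exp_L_evalZ j (a : C) f : exp_L_eval j (a *: f) = a *: exp_L_eval j f.
Proof. exact: (linearZZ (exp_L_eval j)). Qed.

Lemma exp_L_eval_fsum j (I : choiceType) (P : set I) (c : I -> A) : finite_set P ->
  exp_L_eval j (\sum_(i \in P) c i) = \sum_(i \in P) exp_L_eval j (c i).
Proof. exact: (@linear_fsum _ _ (exp_L_eval j)). Qed.

Lemma exp_L_eval_comb j (I : finType) (a : C) (c : I -> C) (X : I -> A) :
  exp_L_eval j (a *: \sum_i c i *: X i) = a *: \sum_i c i *: exp_L_eval j (X i).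
Proof. exact: (@linear_comb _ _ (exp_L_eval j)). Qed.

Lemma exp_L_eval_schurM i j la f : i != j ->
  exp_L_eval j (schur la (pvar R i) * f) = schur la (pvar R i) * exp_L_eval j f.
Proof. by move=> ij; exact: (exp_L_eval_schur_semilinear la ij). Qed.

Lemma exp_L_eval_prod_schur j la (s : seq nat) (f : A) : j \notin s ->
  exp_L_eval j (\prod_(i <- s) schur la (pvar R i) * f) =
  \prod_(i <- s) schur la (pvar R i) * exp_L_eval j f.
Proof.
elim: s => [|i s IH]; first by rewrite big_nil !mul1r.
rewrite inE negb_or eq_sym => /andP[ij js]; rewrite big_cons -!mulrA.
rewrite [LHS](exp_L_eval_schurM _ _ ij).
apply: (congr1 (fun z => _ * z)); exact: IH.
Qed.

End PowerSumPolynomials.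

(** * Evaluation of Schur functions *)

Lemma finite_partitions d : finite_set (partitions d).
Proof.
(* A partition of [d] has at most [d] parts, each at most [d]; padded with zeros, it becomes such a
   tuple. *)
pose F (t : d.-tuple 'I_d.+1) := [seq n <- map val t | n != 0%N].
apply: (@sub_finite_set _ _ (F @` [set: d.-tuple 'I_d.+1])%classic); last first.
  by apply: finite_image; apply: finite_finset.
move=> la [/andP[_ la0] la_d].
have le_d n : n \in la -> (n <= d)%N.
  by move=> nla; rewrite -la_d (perm_sumn (perm_to_rem nla)) leq_addr.
have size_la : (size la <= d)%N.
  rewrite -la_d; elim: la la0 {la_d le_d} => //= n la IH.
  by rewrite inE negb_or => /andP[n0 /IH]; lia.
exists [tuple inord (nth 0%N la i) | i < d] => //.
rewrite /F /= -map_comp; transitivity [seq n <- la ++ nseq (d - size la) 0%N | n != 0%N].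
  congr filter; apply: (@eq_from_nth _ 0%N).
    by rewrite size_map size_enum_ord size_cat size_nseq subnKC.
  move=> i; rewrite size_map size_enum_ord => id.
  rewrite (nth_map (Ordinal id)) ?size_enum_ord//= nth_enum_ord// nth_cat.
  have [ila|ila] := ltnP i (size la); first by rewrite inordK// ltnS le_d// mem_nth.
  by rewrite nth_nseq if_same nth_default// inordK.
rewrite filter_cat filter_nseq cats0.
by apply/all_filterP/allP => n nla; apply: contraNneq la0 => <-.
Qed.

Lemma finite_partitions_le N d : finite_set (partitions_le N d).
Proof. by apply: sub_finite_set (finite_partitions d) => la []. Qed.

Section SchurEvaluation.

Variable R : realType.
Local Notation C := R[i].
Local Notation A := {malg C[{cmonom (nat * nat)%type}]}.

(** The character depends only on the cycle type, so a class contributes one equal term per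
    element. *)
Lemma sum_partitions_classes (V : lmodType C) la (X : seq nat -> V) :
  \sum_(De \in partitions (sumn la))
    ((#|cclass (sumn la) De|%:R * (chi la De)%:~R : C) *: X De) =
  \sum_(s : 'S_(sumn la)) ((irr_val la s)%:~R : C) *: X (cycle_type s).
Proof.
set d := sumn la; rewrite fsbig_finite; last exact: finite_partitions.
transitivity (\sum_(De <- fset_set (partitions d)) \sum_(s : 'S_d | cycle_type s == De)
    ((irr_val la s)%:~R : C) *: X (cycle_type s)).
  apply: eq_bigr => De _.
  rewrite (eq_bigr (fun=> ((chi la De)%:~R : C) *: X De)) => [|s /eqP sDe].
    rewrite sumr_const -[RHS]scaler_nat [RHS]scalerA; congr (_%:R * _ *: _).
    by apply: eq_card => s; rewrite inE.
  have sC : s \in cclass d De by rewrite inE sDe.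
  rewrite sDe /chi; congr (_%:~R *: _); apply: irr_val_cycle_type.
  by have := mem_repr _ sC; rewrite inE sDe => /eqP.
rewrite (exchange_big_dep xpredT)//=; apply: eq_bigr => s _.
rewrite -big_filter (_ : [seq De <- _ | _] = [:: cycle_type s]) ?big_seq1//.
rewrite (eq_filter (a2 := pred1 (cycle_type s))) => [|De]; last by rewrite /= eq_sym.
apply: filter_pred1_uniq; first exact: fset_uniq.
have : cycle_type s \in fset_set (partitions d); last by [].
rewrite in_fset_set; last exact: finite_partitions.
by apply: mem_set; apply: cycle_type_part.
Qed.

Lemma exp_L_eval_cycle_type d (s : 'S_d) j :
  exp_L_eval j (psum_part (pvar R j) (cycle_type s)) =
    #|[set h : 'S_d | (h * h == s)%g]|%:R.
Proof.
have psum_perm (a b : seq nat) : perm_eq a b ->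
    exp_L_eval j (psum_part (pvar R j) a) = exp_L_eval j (psum_part (pvar R j) b).
  by move=> ab; congr exp_L_eval; apply: perm_big.
have SymT h : h \in Sym [set: 'I_d] by apply/mem_SymP => u; rewrite inE.
have E := @card_sqrt_set _ _ (fun De => exp_L_eval j (psum_part (pvar R j) De)) psum_perm
  _ (fun m De _ => exp_L_eval_psum_cons R j m De) _ _ (SymT s).
transitivity (#|sqrt_set [set: 'I_d] s|%:R : A).
  rewrite E; last by rewrite /psum_part big_nil exp_L_eval1.
  apply: psum_perm; rewrite /cycle_type perm_sort.
  rewrite (_ : [set porbit s u | u in [set: 'I_d]] = porbits s)//.
  by apply/setP => X; apply/imsetP/imsetP => -[u _ ->]; exists u; rewrite ?inE.
by congr _%:R; apply: eq_card => h; rewrite [LHS]in_set [RHS]in_set SymT.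
Qed.

(** Evaluated, the Schur function is [1 / d!] times the sum over [s] of [chi(s)] times the number of
    roots of [s]. Regrouped by roots, this is the average of [chi(h * h)], the indicator. *)
Lemma exp_L_eval_schur la j : exp_L_eval j (schur la (pvar R j)) = 1.
Proof.
rewrite /schur sum_partitions_classes.
rewrite [LHS]exp_L_eval_comb; set d := sumn la.
pose c (h : 'S_d) : C := (irr_val la (h * h)%g)%:~R.
rewrite (eq_bigr (fun s => \sum_(h | (h * h)%g == s) c h *: (1 : A))) => [|s _].
  have part : \sum_h c h *: (1 : A) = \sum_s \sum_(h | (h * h)%g == s) c h *: (1 : A).
    exact: (partition_big (fun h : 'S_d => h * h)%g xpredT).
  rewrite -part -scaler_suml.
  rewrite -rmorph_sum /= sum_irr_val_sqr scalerA -pmulrn mulVf ?scale1r//.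
  by rewrite pnatr_eq0 -lt0n fact_gt0.
rewrite [X in _ *: X = _]exp_L_eval_cycle_type.
rewrite (eq_bigr (fun=> ((irr_val la s)%:~R : C) *: (1 : A))) => [|h /eqP<-]; last first.
  exact: erefl.
rewrite sumr_const -[RHS]scaler_nat [RHS]scalerA mulrC -[RHS]scalerA scaler_nat cardsE.
exact: erefl.
Qed.

End SchurEvaluation.

(** * Erasing one Schur factor from the tau functions *)

Theorem mainTheorem7 (R : realType) :
  (forall (beta : R[i]) (k : nat) (q t nu : 'I_k -> R[i])
     (Log : 'I_k -> seq nat -> R[i] -> R[i]),
     (forall i la z, z != 0 -> cexp (Log i la z) = z) ->
     let r := r_exp beta q t nu Log in
     forall (E : int) (F : nat) (N n : int), (0 < F)%N ->
     forall d : nat,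
       tau r (E - 1) F.-1 N n (@pvar R) d =
       at_p0 F (exp_op (L_op F) (tau r E F N n (@pvar R) d)))
  /\
  (forall (g r : int -> R[i]) (n M N : int), N = n - M ->
     let r' := cut r M in
     forall d : nat,
       tauBKP g r N n (@pvar R 1) d =
       at_p0 2 (exp_op (fun f => (2^-1 : R[i]) *: Linf 2 f)
         (tauTL g r' (n - N) n (@pvar R 1) (@pvar R 2) d))).
Proof.
split=> [beta k q t nu Log _ r E F N n F_gt0 d|g r n M N NE r' d].
  transitivity (exp_L_eval F (tau r E F N n (@pvar R) d)); last exact: erefl.
  rewrite /tau [RHS]exp_L_eval_fsum; last exact: finite_partitions_le.
  apply: eq_fsbigr => la _; rewrite [RHS]exp_L_evalZ.
  have -> : E - 1 - F.-1%:Z = E - F%:Z by lia.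
  apply: (congr1 (fun z => _ *: z)); rewrite prednK// big_nat_recr//=.
  rewrite [RHS]exp_L_eval_prod_schur; last by rewrite mem_index_iota ltnn andbF.
  rewrite [X in _ = _ * X]exp_L_eval_schur; exact/esym/mulr1.
transitivity (exp_L_eval 2 (tauTL g r' (n - N) n (@pvar R 1) (@pvar R 2) d)); last first.
  by rewrite /exp_L_eval -half_Linf.
rewrite /tauBKP /tauTL [RHS]exp_L_evalZ; apply: (congr1 (fun z => _ *: z)).
rewrite [RHS]exp_L_eval_fsum; last exact: finite_partitions_le.
have -> : n - (n - N) = N by lia.
apply: eq_fsbigr => la /set_mem[[la_part la_d] la_N]; rewrite [RHS]exp_L_evalZ.
(* Here [l(la) <= N = n - M], so no box of [la] meets the zero of [r']; this bound also forces
   [M <= n]. *)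
have -> : r_content r' la n = r_content r la n.
  by rewrite r_content_cut ?la_part -?NE ?la_N//; lia.
apply: (congr1 (fun z => _ *: z)).
rewrite [RHS]exp_L_eval_schurM// [X in _ = _ * X]exp_L_eval_schur.
exact/esym/mulr1.
Qed.
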